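(* The decision problem FireFighting — given a graph $G$ and $m\in\mathbb{N}_{>0}$, decide whether $\text{ffn}(G)\le m$ — is NP-hard.
   Context: All graphs are finite, simple and undirected. For a graph $G=(V,E)$ and $W\subseteq V$, $N(W)$ is the set of nodes in $V\setminus W$ adjacent to at least one node of $W$. For $m\in\mathbb{N}_{>0}$, an $m$-strategy of length $T$ is a sequence $(F_1,\dots,F_T)$ of subsets of $V$ with $|F_i|\le m$. Its burning sets are $B_0=V$ and $B_t=(B_{t-1}\setminus F_t)\cup N(B_{t-1}\setminus F_t)$ for $t\ge1$, where $F_t=\emptyset$ for $t>T$. The strategy is winning if $B_T=\emptyset$. The firefighter number $\text{ffn}(G)$ is the smallest $m$ for which a winning $m$-strategy for $G$ exists. *)

(* Defs.v *)
From HB Require Import structures.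
From mathcomp Require Import all_boot all_order all_algebra.
From mathcomp Require Import boolp.

Set Implicit Arguments.
Unset Strict Implicit.
Unset Printing Implicit Defensive.

Record sgraph (V : finType) := SGraph {
  adj :> rel V;
  adj_sym : symmetric adj;
  adj_irr : irreflexive adj
}.

Section FireFighter.
Variables (V : finType) (G : sgraph V).

Definition nbhd (W : {set V}) : {set V} :=
  [set v | (v \notin W) && [exists w in W, adj G w v]].

(* A strategy (F_1, ..., F_T) is the sequence F of size T whose item of index
   t is F_{t+1}; reading past the end gives the empty set. *)
Fixpoint burning (F : seq {set V}) (t : nat) : {set V} :=
  if t is t'.+1 then
    let W := burning F t' :\: nth set0 F t' in W :|: nbhd W
  else setT.

Definition strategy (m : nat) (F : seq {set V}) : Prop :=
  forall A, A \in F -> #|A| <= m.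

Definition winning (F : seq {set V}) : Prop := burning F (size F) = set0.

Definition winnable (m : nat) : Prop :=
  0 < m /\ exists F, strategy m F /\ winning F.

Lemma winnable_ex : exists m, `[< winnable m >].
Proof.
exists #|V|.+1; apply/asboolP; split=> //; exists [:: setT]; split.
  by move=> A _; apply: leq_trans (max_card _) (leqnSn _).
rewrite /winning /= setDT set0U; apply/setP=> v; rewrite !inE /=.
by apply/existsP=> -[w]; rewrite inE.
Qed.

Definition ffn : nat := ex_minn winnable_ex.

End FireFighter.

Inductive move := MoveL | MoveS | MoveR.

Definition move_to (d : move) : option bool :=
  match d with MoveL => Some false | MoveS => None | MoveR => Some true end.
Definition move_of (o : option bool) : move :=
  match o with Some false => MoveL | None => MoveS | Some true => MoveR end.
Lemma move_toK : cancel move_to move_of. Proof. by case. Qed.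
HB.instance Definition _ := Finite.copy move (can_type move_toK).

(* Tape symbols over the auxiliary alphabet A: None is the blank and
   Some (inl b) is the input/output bit b. *)
Definition sym (A : finType) : finType := option (bool + A)%type.

(* Nondeterministic Turing machine with (extra M).+1 tapes. A machine has no
   separate halting states: it halts when no transition applies. *)
Record TM := MkTM {
  extra : nat;
  aux : finType;
  state : finType;
  start : state;
  accepting : {set state};
  trans : state -> {ffun 'I_extra.+1 -> sym aux} ->
          {set state * {ffun 'I_extra.+1 -> sym aux * move}}
}.

Definition deterministic (M : TM) : Prop :=
  forall (q : state M) r, #|trans q r| <= 1.

(* (l, a, r) is the two-way infinite tape whose head reads a, with l to the
   left of the head (nearest cell first), r to the right, blanks beyond. *)
Definition tape (A : finType) := (seq (sym A) * sym A * seq (sym A))%type.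

Definition move_tape A (d : move) (x : tape A) : tape A :=
  let: (l, a, r) := x in
  match d with
  | MoveL => (behead l, head None l, a :: r)
  | MoveS => x
  | MoveR => (a :: l, head None r, behead r)
  end.

Definition write_move A (y : sym A * move) (x : tape A) : tape A :=
  let: (l, _, r) := x in move_tape y.2 (l, y.1, r).

Definition input_tape A (w : seq bool) : tape A :=
  let s := [seq Some (inl b) : sym A | b <- w] in
  ([::], head None s, behead s).

Fixpoint bit_prefix A (s : seq (sym A)) : seq bool :=
  if s is Some (inl b) :: s' then b :: bit_prefix s' else [::].

(* The output is the maximal block of bits starting at the head. *)
Definition output A (x : tape A) : seq bool :=
  let: (_, a, r) := x in bit_prefix (a :: r).

Section Runs.
Variable M : TM.

Definition config := (state M * {ffun 'I_(extra M).+1 -> tape (aux M)})%type.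

Definition init (w : seq bool) : config :=
  (start M, [ffun i => input_tape (aux M) (if i == ord0 then w else [::])]).

Definition options (c : config) := trans c.1 [ffun i => (c.2 i).1.2].

Definition step (c c' : config) : Prop :=
  exists2 a, a \in options c &
    c' = (a.1, [ffun i => write_move (a.2 i) (c.2 i)]).

Fixpoint steps (n : nat) (c c' : config) : Prop :=
  if n is n'.+1 then exists2 d, step c d & steps n' d c' else c = c'.

Definition halted (c : config) : Prop := options c = set0.

(* Every computation path, accepting or not, obeys the time bound. *)
Definition poly_time : Prop :=
  exists p : {poly nat},
    forall w n c, steps n (init w) c -> n <= p.[size w]%R.

Definition accepts (w : seq bool) : Prop :=
  exists n c, [/\ steps n (init w) c, halted c & c.1 \in accepting M].

Definition computes (f : seq bool -> seq bool) : Prop :=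
  forall w, exists n c,
    [/\ steps n (init w) c, halted c & output (c.2 ord0) = f w].

End Runs.

Definition language := seq bool -> Prop.

Definition NP (L : language) : Prop :=
  exists M : TM, poly_time M /\ forall w, L w <-> accepts M w.

Definition poly_computable (f : seq bool -> seq bool) : Prop :=
  exists M : TM, [/\ deterministic M, poly_time M & computes M f].

Definition poly_reducible (L L' : language) : Prop :=
  exists f, poly_computable f /\ forall w, L w <-> L' (f w).

Definition NP_hard (L : language) : Prop :=
  forall L', NP L' -> poly_reducible L' L.

(* Binary digits of m > 0, least significant first. *)
Definition binary (m : nat) : seq bool :=
  mkseq (fun i => odd (m %/ 2 ^ i)) (trunc_log 2 m).+1.

(* 1^n 0, then the n * n bits of the adjacency matrix in row-major order,
   then m in binary. *)
Definition encode (n : nat) (G : sgraph 'I_n) (m : nat) : seq bool :=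
  nseq n true ++ false ::
  [seq adj G i j | i <- enum 'I_n, j <- enum 'I_n] ++ binary m.

Definition FireFighting : language := fun w =>
  exists (n : nat) (G : sgraph 'I_n) (m : nat),
    [/\ 0 < m, w = encode G m & ffn G <= m].

(* Main.v *)
From HB Require Import structures.
From mathcomp Require Import all_boot all_order all_algebra.
From mathcomp Require Import boolp zify.
Require Import Defs.

Set Implicit Arguments.
Unset Strict Implicit.
Unset Printing Implicit Defensive.

(** Acceptance of a nondeterministic machine is a clique problem: a point is a
    time step together with the local data read, written and guessed there (the
    state, the symbols under the heads, the head positions and, for every tape,
    the last time the current cell was visited), and a run is a choice of one
    point for every time such that all pairs are compatible; compatibility
    involves two points only because the last visits are guessed.

    A clique problem becomes a firefighter problem by blowing up the vertices of
    a split graph into cliques of twins.  The clique part Q has exactly m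
    vertices.  As long as some vertex of Q is not protected, the clean set is a
    set S of independent classes, and it can only grow while enough of Q is not
    adjacent to S.  Once Q is protected entirely, S can only grow if enough of Q
    is adjacent to nothing outside S.  The weights are such that both conditions
    can be met iff some set of at most k points spans k^2 ordered compatible
    pairs.

    The adjacency matrix is a quantifier-free condition on the digits of the two
    indices, so it is printed by nested loops over unary counters, which a
    multi-tape machine runs with one stack per tape. *)

(** * Clearing sets and the gadget graph *)

(** Two constraints shape the construction. The graph must be printed by code that knows only unary
    counters, so vertices are vectors of base-[B] digits and classes are cut out by conditions on
    digits; their sizes can then be read off, and every vertex left over goes to the hub, the one
    class whose weight needs only a lower bound. And a strategy may clean the classes in any order,
    so the gadget must also resist an attack from the opposite side. The intended route: while at
    most k points together with [o1] and [oy] are clean, the untouched point classes of Q leave room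
    [L] for one more class; once Q is protected, the pairs spanned by these points free room [c],
    just enough for [oh]; this frees the hub, which pays for everything else. Starting from [o2] and
    [oh] is the mirror image: untouched and enclosed parts of Q exchange their roles, and the
    complement of the clean points takes the place of the chosen set. In the application k is the
    number [B] of time steps, and [c] is k^2 because a point is compatible with itself. *)

Section Clearing.
Variables (V : finType) (G : sgraph V) (m : nat).

(** The recursion for burning sets in complemented form: a vertex is clean after a step iff its
    closed neighbourhood was clean or protected. Strategies are studied below only through their
    clean sets. *)
Definition core (Y : {set V}) : {set V} :=
  [set x | [forall y, ((y == x) || adj G y x) ==> (y \in Y)]].

Lemma coreP (Y : {set V}) x :
  reflect (x \in Y /\ forall y, adj G y x -> y \in Y) (x \in core Y).
Proof.
rewrite inE; apply: (iffP forallP) => [H|[xY H] y].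
  split=> [|y xy]; first by have := H x; rewrite eqxx.
  by have := H y; rewrite xy orbT.
by apply/implyP=> /orP[/eqP->//|]; apply: H.
Qed.

Lemma core_sub (Y Z : {set V}) : Y \subset Z -> core Y \subset core Z.
Proof.
move=> YZ; apply/subsetP=> x /coreP[xY H]; apply/coreP; split.
  exact: (subsetP YZ).
by move=> y /H; apply: (subsetP YZ).
Qed.

Lemma burning_core F t :
  ~: burning G F t.+1 = core (~: burning G F t :|: nth set0 F t).
Proof.
apply/setP=> x; rewrite -[burning G F t.+1]/(_ :|: nbhd G _).
set W := _ :\: _.
have -> : ~: burning G F t :|: nth set0 F t = ~: W.
  by rewrite /W setCD.
rewrite !in_setC in_setU negb_or; apply/andP/coreP => [[xW]|[xW H]].
  rewrite inE xW /= => /existsP H; split; first by rewrite inE.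
  move=> y yx; rewrite inE; apply/negP=> yW; apply: H.
  by exists y; rewrite yW.
rewrite inE in xW; split=> //; rewrite inE xW /=.
by apply/existsP=> -[y /andP[yW /H]]; rewrite inE yW.
Qed.

Lemma burning_rcons F A t :
  t <= size F -> burning G (rcons F A) t = burning G F t.
Proof.
elim: t => // t IH tF; rewrite /= IH ?(ltnW tF) //.
by rewrite nth_rcons tF.
Qed.

(** Inclusion instead of equality: a construction may forget clean vertices that it does not
    control. *)
Definition clears (C : {set V}) :=
  exists F, strategy m F /\ C \subset ~: burning G F (size F).

Lemma clears0 : clears set0.
Proof. by exists [::]; split=> //; rewrite sub0set. Qed.

Lemma clears_sub (C D : {set V}) : D \subset C -> clears C -> clears D.
Proof. by move=> DC [F [sF CF]]; exists F; split=> //; apply: subset_trans CF. Qed.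

Lemma clears_core (C A : {set V}) : clears C -> #|A| <= m -> clears (core (C :|: A)).
Proof.
case=> F [sF CF] Am; exists (rcons F A); split.
  by move=> D; rewrite mem_rcons inE => /predU1P[->|/sF].
rewrite size_rcons burning_core burning_rcons // nth_rcons ltnn eqxx.
by apply: core_sub; apply: setSU.
Qed.

Lemma winnable_clears : 0 < m -> winnable G m <-> clears setT.
Proof.
move=> m0; split=> [[_ [F [sF wF]]]|[F [sF wF]]].
  by exists F; split=> //; rewrite wF setC0.
split=> //; exists F; split=> //.
by apply/eqP; rewrite -subset0 -setCS setC0.
Qed.

Lemma clean_invariant (P : {set V} -> Prop) F t :
  strategy m F -> P set0 ->
  (forall C A : {set V}, P C -> #|A| <= m -> P (core (C :|: A))) ->
  P (~: burning G F t).
Proof.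
move=> sF P0 PS; elim: t => [|t IH]; first by rewrite /= setCT.
rewrite burning_core; apply: PS => //.
have [tF|tF] := ltnP t (size F); first by apply/sF/mem_nth.
by rewrite nth_default // cards0.
Qed.

End Clearing.

Lemma winnable_mono (V : finType) (G : sgraph V) m m' :
  m <= m' -> winnable G m -> winnable G m'.
Proof.
move=> mm [m0 [F [sF wF]]]; split; first exact: leq_trans mm.
by exists F; split=> // A /sF /leq_trans; apply.
Qed.

Lemma ffn_le (V : finType) (G : sgraph V) m :
  ffn G <= m <-> winnable G m.
Proof.
rewrite /ffn; case: ex_minnP => m' /asboolP wm' min; split=> [/winnable_mono|].
  exact.
by move=> wm; apply: min; apply/asboolP.
Qed.

(** * The weighted split graph *)

Section Gadget.
Variables (V : finType) (E : rel V).

Definition ocls := (V + bool * bool)%type.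
Definition qcls := (V * V + (V + unit))%type.
Definition cls := (ocls + qcls)%type.

(* [o1] and [oy] have the same neighbours: one of them could be cleared with the
   help of the classes gained through [o2] and [oh], but not both at once. *)
Definition o1 : ocls := inr (false, false).
Definition oy : ocls := inr (false, true).
Definition o2 : ocls := inr (true, false).
Definition oh : ocls := inr (true, true).

(** The point classes of Q avoid [o1] and [oy] and provide the room of the first phase. The pair
    classes need only their two points, [o1] and [oy], and pay for [oh]. The hub needs [o1], [oy]
    and [oh], and pays for the rest. *)
Definition inc (q : qcls) (o : ocls) : bool :=
  match q, o with
  | inl (u, v), inl x => (x == u) || (x == v)
  | inl _, inr (b, _) => ~~ b
  | inr (inl v), inl x => x == v
  | inr (inl _), inr (b, _) => b
  | inr (inr _), inl _ => false
  | inr (inr _), inr (b, b') => ~~ b || b'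
  end.

(** Members of one class are adjacent, even in the independent part: one clean vertex of a class
    thus shows that the whole class was clean or protected one step before. *)
Definition link (c d : cls) : bool :=
  match c, d with
  | inl o, inl o' => o == o'
  | inl o, inr q => inc q o
  | inr q, inl o => inc q o
  | inr _, inr _ => true
  end.

Definition epairs (U : {set V}) :=
  #|[set p : V * V | [&& p.1 \in U, p.2 \in U & E p.1 p.2]]|.

Variables (k a L c : nat) (X : finType) (G : sgraph X) (cl : X -> cls).
Hypothesis adjE : forall x y, adj G x y = (x != y) && link (cl x) (cl y).
Definition wt (d : cls) := #|[set x | cl x == d]|.
Hypothesis wO : forall o, o != oh -> wt (inl o) = L.
Hypothesis wh : wt (inl oh) = c.
Hypothesis wE : forall u v, wt (inr (inl (u, v))) = E u v :> nat.
Hypothesis wV : forall v, wt (inr (inr (inl v))) = a.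
Hypothesis wQ : L <= wt (inr (inr (inr tt))).
(** One point beyond k lowers the room left by the point classes from [L] to [L - a], and a gain
    below [c <= a] cannot repair this. The bound on [c.*2] prevents [o2] from being paid for by a
    slack and a gain that are both below [c]. *)
Hypotheses (LE : L = a * (#|V| - k)) (cL : c.*2 <= L) (ca : c <= a) (c0 : 0 < c).
Hypothesis kV : k < #|V|.

Definition qv : {set X} := [set x | if cl x is inr _ then true else false].
Local Notation m := #|qv|.
Definition qcount (P : pred qcls) :=
  #|[set x | if cl x is inr q then P q else false]|.
Definition inside (S : {set ocls}) : pred qcls :=
  fun q => [forall o, inc q o ==> (o \in S)].
Definition outside (S : {set ocls}) : pred qcls :=
  fun q => [forall o, inc q o ==> (o \notin S)].
(** Both numbers are savings on the cost m of protecting Q: [gain] counts the clique vertices that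
    can be clean together with [S], [slack] those that may burn without endangering [S]. *)
Definition gain S := qcount (inside S).
Definition slack S := qcount (outside S).
Definition uset (S : {set ocls}) : {set V} := [set v | inl v \in S].
Definition osum (S : {set ocls}) := \sum_(o in S) wt (inl o).
Definition overts (S : {set ocls}) : {set X} :=
  [set x | if cl x is inl o then o \in S else false].

Lemma qcount_sum P : qcount P = \sum_(q | P q) wt (inr q).
Proof.
rewrite /qcount -sum1_card.
rewrite (partition_big (fun x => if cl x is inr q then q else inr (inr tt)) P) /=; last first.
  by move=> x; rewrite inE; case: (cl x).
apply: eq_bigr => q Pq; rewrite sum1_card /wt.
apply: eq_card => x; rewrite !inE unfold_in /= inE.
case: (cl x) => [o|q'] //=; apply/andP/eqP => [[_ /eqP->]//|[->]]; by rewrite Pq eqxx.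
Qed.

Lemma osumE S : #|overts S| = osum S.
Proof.
rewrite -sum1_card /osum.
rewrite (partition_big (fun x => if cl x is inl o then o else oh) (mem S)) /=; last first.
  by move=> x; rewrite inE; case: (cl x).
apply: eq_bigr => o Po; rewrite sum1_card /wt.
apply: eq_card => x; rewrite !inE unfold_in /= inE.
case: (cl x) => [o'|q'] //=; apply/andP/eqP => [[_ /eqP->]//|[->]]; by rewrite Po eqxx.
Qed.

Lemma qcountE (P : pred qcls) :
  qcount P = #|[set p : V * V | P (inl p) && E p.1 p.2]|
    + a * #|[set v | P (inr (inl v))]| + (if P (inr (inr tt)) then wt (inr (inr (inr tt))) else 0).
Proof.
rewrite qcount_sum big_sumType /= big_sumType /= -[RHS]addnA; congr (_ + _).
  rewrite -sum1_card [LHS](bigID (fun p => E p.1 p.2)) /= [X in _ + X]big1 ?addn0; last first.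
    by case=> u v /= /andP[_ /negPf e]; rewrite wE e.
  rewrite [LHS](eq_bigr (fun=> 1)); last by case=> u v /= /andP[_ e]; rewrite wE e.
  by apply: eq_bigl => p; rewrite inE.
congr (_ + _).
  by rewrite (eq_bigr (fun=> a)) // sum_nat_const mulnC; congr (_ * _); apply: eq_card => v; rewrite inE.
by rewrite big_mkcond (big_pred1 tt) //; case.
Qed.

Definition qset (P : pred qcls) : {set X} :=
  [set x | if cl x is inr q then P q else false].
Definition oset (o : ocls) : {set X} := [set x | cl x == inl o].

Lemma qcountC P : qcount P + qcount (predC P) = m.
Proof.
rewrite /qcount -(cardsID (qset P) qv); congr (_ + _).
  by apply: eq_card => x; rewrite !inE; case: (cl x).
by apply: eq_card => x; rewrite !inE; case: (cl x) => //= q; rewrite andbT.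
Qed.

Lemma link_refl d : link d d.
Proof. by case: d => //= o; rewrite eqxx. Qed.

Lemma core_clsP (Y : {set X}) x :
  reflect (forall y, link (cl y) (cl x) -> y \in Y) (x \in core G Y).
Proof.
apply: (iffP (coreP _ _ _)) => [[xY H] y l|H].
  have [->//|yx] := eqVneq y x; apply: H; by rewrite adjE yx.
split=> [|y]; first exact/H/link_refl.
by rewrite adjE => /andP[_]; apply: H.
Qed.

(** What is clean after Q has been protected as a whole on top of the classes in [S]. *)
Definition full S := overts S :|: qset (inside S).

(** * From a dense set of points to a winning strategy *)

Section Sufficiency.
Variable U : {set V}.
Hypotheses (Uk : #|U| <= k) (Uc : c <= epairs U).
Definition s0 : {set ocls} :=
  [set o | match o with inl v => v \in U | inr (b, _) => ~~ b end].

(** The point class of v touches only v, [o2] and [oh]; for v outside [U] none of them is in [s0],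
    and there are at least |V| - k such v. *)
Lemma slack_s0 (S : {set ocls}) : S \subset s0 -> L <= slack S.
Proof.
move=> SS; rewrite /slack qcountE LE.
apply: (@leq_trans (a * #|[set v | outside S (inr (inl v))]|)); last first.
  by rewrite -addnA addnCA leq_addr.
rewrite leq_mul2l; apply/orP; right.
apply: (@leq_trans #|~: U|); first by rewrite cardsCs setCK leq_sub2l.
apply: subset_leq_card; apply/subsetP => v; rewrite !inE => vU.
apply/forallP=> o; apply/implyP=> io; apply/negP => /(subsetP SS); rewrite inE.
by case: o io => [x /eqP->|[[] b]] //; rewrite (negPf vU).
Qed.

(** One class per round: the new class costs [L], and the clique vertices with a neighbour in [S]
    cost at most m - [L]. *)
Lemma clears_overts (S : {set ocls}) : S \subset s0 -> clears G m (overts S).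
Proof.
have [n] := ubnP #|S|; elim: n S => // n IH S /ltnSE Sn SS.
have [->|/set0Pn[o oS]] := eqVneq S set0.
  apply: clears_sub (clears0 _ _); apply/subsetP=> x; rewrite !inE.
  by case: (cl x) => // o; rewrite inE.
have cS : clears G m (overts (S :\ o)).
  apply: IH; last exact: subset_trans (subsetDl _ _) SS.
  by apply: leq_trans Sn; rewrite (cardsD1 o S) oS.
have oh' : o != oh by apply/eqP=> oE; have := subsetP SS _ oS; rewrite oE inE.
have sA : #|oset o :|: qset (predC (outside S))| <= m.
  apply: leq_trans (leq_card_setU _ _) _.
  rewrite -(qcountC (outside S)) leq_add2r -/(wt (inl o)) wO //.
  exact: slack_s0.
apply: clears_sub (clears_core cS sA); apply/subsetP=> x; rewrite inE.
case xo: (cl x) => [o'|//] o'S; apply/core_clsP => y; rewrite xo !inE.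
case: (cl y) => [o''|q] /=.
  by move/eqP->; rewrite !inE o'S; have [->|] := eqVneq o' o; rewrite ?eqxx ?orbT.
by move=> io; apply/forallP => /(_ o'); rewrite io o'S.
Qed.

Lemma clears_full (S : {set ocls}) : clears G m (overts S) -> clears G m (full S).
Proof.
move/clears_core=> /(_ qv (leqnn _)); apply: clears_sub.
apply/subsetP=> x xS; apply/core_clsP => y; move: xS; rewrite !inE.
case yE: (cl y) => [o|q]; last by rewrite orbT.
case: (cl x) => [o'|q] /=; first by rewrite !orbF => ? /eqP->.
by move=> /forallP/(_ o)/implyP H /H ->.
Qed.

(** Here all of Q is kept clean or protected; the clique vertices that are clean already leave their
    share of the budget to the class [o]. *)
Lemma clears_add (S : {set ocls}) o :
  wt (inl o) <= gain S -> clears G m (full S) -> clears G m (full (o |: S)).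
Proof.
move=> wo cS.
have sA : #|oset o :|: qset (predC (inside S))| <= m.
  apply: leq_trans (leq_card_setU _ _) _.
  by rewrite -(qcountC (inside S)) leq_add2r.
apply: clears_sub (clears_core cS sA); apply/subsetP=> x xS.
apply/core_clsP => y; rewrite !inE.
case yE: (cl y) => [o'|q] /=; last by case: (inside S q).
have [->|no] := eqVneq o' o; first by rewrite eqxx !orbT.
move: xS; rewrite !inE; case: (cl x) => [o''|q] /=.
  by rewrite orbF !inE => H /eqP oE; move: H; rewrite -oE (negPf no) /= => ->.
by move=> /forallP/(_ o')/implyP H /H; rewrite !inE (negPf no) /= => ->.
Qed.

Lemma gain_ge_c (S : {set ocls}) : s0 \subset S -> c <= gain S.
Proof.
move=> SS; apply: leq_trans Uc _; rewrite /gain qcountE -addnA.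
apply: leq_trans (leq_addr _ _); apply: subset_leq_card.
apply/subsetP=> -[u v]; rewrite !inE /= => /and3P[uU vU ->]; rewrite andbT.
apply/forallP=> o; apply/implyP=> io; apply: (subsetP SS); rewrite inE.
by case: o io => [x /orP[]/eqP->|[b b']].
Qed.

(** All neighbours of the hub outside Q are in [S], and the hub alone weighs at least [L]. *)
Lemma gain_ge_L (S : {set ocls}) : s0 \subset S -> oh \in S -> L <= gain S.
Proof.
move=> SS hS; apply: leq_trans wQ _; rewrite /gain qcountE.
suff -> : inside S (inr (inr tt)) by rewrite leq_addl.
apply/forallP=> o; apply/implyP; case: o => [//|[[] []]] //= _;
  by apply: (subsetP SS); rewrite inE.
Qed.

Lemma sufficiency : clears G m setT.
Proof.
have c1 : clears G m (full (oh |: s0)).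
  apply: clears_add; first by rewrite wh gain_ge_c.
  exact/clears_full/clears_overts.
(* With [oh] clean the hub pays for any further class, so the remaining classes are added one by one
   in any order. *)
suff H (S : {set ocls}) : clears G m (full (S :|: (oh |: s0))).
  apply: clears_sub (H setT); rewrite setTU; apply/subsetP=> x _; rewrite !inE.
  by case: (cl x) => [o|q]; rewrite ?inE //=; apply/forallP => o; rewrite inE implybT.
have [n] := ubnP #|S|; elim: n S => // n IH S /ltnSE Sn.
have [->|/set0Pn[o oS]] := eqVneq S set0; first by rewrite set0U.
have [oE|no] := eqVneq o oh; last first.
  rewrite -(setD1K oS) -setUA; apply: clears_add.
    rewrite wO //; apply: gain_ge_L; last by rewrite !inE eqxx orbT.
    by apply/subsetP => x xs; rewrite !inE; move: xs; rewrite inE => ->; rewrite !orbT.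
  by apply: IH; apply: leq_trans Sn; rewrite (cardsD1 o S) oS.
have : clears G m (full (S :\ oh :|: (oh |: s0))).
  by apply: IH; apply: leq_trans Sn; rewrite (cardsD1 oh S) -oE oS.
apply: clears_sub.
suff -> : S :|: (oh |: s0) = S :\ oh :|: (oh |: s0) by [].
by apply/setP=> x; rewrite !inE; case: eqP => //=; rewrite orbT.
Qed.
End Sufficiency.

(** * From a winning strategy to a dense set of points *)

Section Necessity.
Hypothesis few : forall U : {set V}, #|U| <= k -> epairs U < c.

(** The two sides from which a clean set can grow exclude each other. With both [o1] and [oy] the
    points stay few and [oh] is out of reach. With [o2] and [oh] the bound is the mirror image:
    beyond it, the slack would consist of pairs that avoid [uset S], hence of pairs within at most k
    points. *)
Definition clean_inv (S : {set ocls}) : Prop :=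
  [/\ o2 \in S -> o1 \notin S /\ oy \notin S,
      o1 \in S -> oy \in S -> oh \notin S /\ #|uset S| <= k
    & o2 \in S -> oh \in S -> #|uset S| < #|V| - k].

Lemma qcount_bound (P : pred qcls) (A : {set V * V}) (B : {set V}) :
  (forall u v, P (inl (u, v)) -> E u v -> (u, v) \in A) ->
  (forall v, P (inr (inl v)) -> v \in B) -> ~~ P (inr (inr tt)) ->
  qcount P <= #|A| + a * #|B|.
Proof.
move=> PA PB /negPf PN; rewrite qcountE PN addn0; apply: leq_add.
  apply: subset_leq_card; apply/subsetP => -[u v]; rewrite inE => /andP[]; exact: PA.
rewrite leq_mul2l subset_leq_card ?orbT //; apply/subsetP => v; rewrite inE; exact: PB.
Qed.

Lemma insideF (S : {set ocls}) q o : inc q o -> o \notin S -> ~~ inside S q.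
Proof. by move=> io /negPf oS; apply/forallP => /(_ o); rewrite io oS. Qed.

Lemma outsideF (S : {set ocls}) q o : inc q o -> o \in S -> ~~ outside S q.
Proof. by move=> io oS; apply/forallP => /(_ o); rewrite io oS. Qed.

Lemma insideW (S : {set ocls}) q o : inside S q -> inc q o -> o \in S.
Proof. by move=> /forallP/(_ o)/implyP. Qed.

Lemma outsideW (S : {set ocls}) q o : outside S q -> inc q o -> o \notin S.
Proof. by move=> /forallP/(_ o)/implyP. Qed.

(** By the invariant [o1] is missing, so neither pairs nor the hub contribute; a point class needs
    [oh] and its own point. *)
Lemma gain_o2 S : clean_inv S -> o2 \in S ->
  gain S <= if oh \in S then a * #|uset S| else 0.
Proof.
case=> + _ _ => /[apply] -[o1S _] .
have -> : (if oh \in S then a * #|uset S| else 0)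
   = #|(set0 : {set V * V})| + a * #|if oh \in S then uset S else set0|.
  by rewrite cards0; case: ifP; rewrite ?cards0 ?muln0.
apply: qcount_bound => [u v /insideW/(_ (isT : inc (inl (u, v)) o1))|v iv|].
- by rewrite (negPf o1S).
- rewrite (insideW iv (isT : inc (inr (inl v)) oh)) inE (insideW iv) //=; exact/eqxx.
- exact: (insideF (o := o1)).
Qed.

Lemma gain_o1 S : clean_inv S -> o2 \notin S ->
  gain S <= if (o1 \in S) && (oy \in S) then epairs (uset S) else 0.
Proof.
case=> _ I2 _ o2S.
have -> : (if (o1 \in S) && (oy \in S) then epairs (uset S) else 0)
   = #|if (o1 \in S) && (oy \in S) then
        [set p : V * V | [&& p.1 \in uset S, p.2 \in uset S & E p.1 p.2]] else set0|
     + a * #|(set0 : {set V})|.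
  by rewrite cards0 muln0 addn0; case: ifP; rewrite ?cards0.
apply: qcount_bound => [u v iv e|v|].
- rewrite (insideW iv (isT : inc (inl (u, v)) o1)) (insideW iv (isT : inc (inl (u, v)) oy)) /=.
  by rewrite !inE e !(insideW iv) //= eqxx ?orbT.
- by move/insideW/(_ (isT : inc (inr (inl v)) o2)); rewrite (negPf o2S).
- apply/negP=> iS; have [] := I2 (insideW iS (isT : inc (inr (inr tt)) o1))
    (insideW iS (isT : inc (inr (inr tt)) oy)).
  by rewrite (insideW iS).
Qed.

Lemma gain_c_lt S : clean_inv S -> o2 \notin S -> gain S < c.
Proof.
move=> iS o2S; apply: leq_ltn_trans (gain_o1 iS o2S) _; case: ifP => // /andP[s1 sy].
by case: iS => _ /(_ s1 sy)[_ /few].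
Qed.

Lemma gain_L_lt S : clean_inv S -> o2 \in S -> gain S + a <= L.
Proof.
move=> iS o2S; apply: (@leq_trans (a * (#|V| - k.+1) + a)).
  rewrite leq_add2r; apply: leq_trans (gain_o2 iS o2S) _; case: ifP => // hS.
  rewrite leq_mul2l; case: iS => _ _ /(_ o2S hS); lia.
by rewrite LE -mulnSr leq_mul2l; apply/orP; right; lia.
Qed.

Lemma wt_ge o : c <= wt (inl o).
Proof. by have [->|/wO->] := eqVneq o oh; rewrite ?wh //; lia. Qed.

(** Gain alone never pays for a class, so nothing is won while Q is fully protected. *)
Lemma gain_lt S o : clean_inv S -> o \notin S -> gain S < wt (inl o).
Proof.
move=> iS oS; case o2S: (o2 \in S); last first.
  by apply: leq_trans (gain_c_lt iS (negbT o2S)) (wt_ge o).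
have [oE|no] := eqVneq o oh.
  apply: leq_trans (wt_ge o); apply: leq_ltn_trans (gain_o2 iS o2S) _.
  by rewrite -oE (negPf oS).
rewrite wO //; have := gain_L_lt iS o2S; lia.
Qed.

(** [o2] touches all point classes; [o1], and likewise [oy], touches all pairs and the hub. *)
Lemma slack0_o2 (S : {set ocls}) : o2 \in S -> (o1 \in S) || (oy \in S) -> slack S = 0.
Proof.
move=> s2 s1; apply/eqP; rewrite -leqn0.
apply: (@leq_trans (#|(set0 : {set V * V})| + a * #|(set0 : {set V})|)); last first.
  by rewrite !cards0 muln0.
apply: qcount_bound => [u v iv|v iv|].
- by case/orP: s1 => [/(@outsideF _ (inl (u, v)) o1 isT)|/(@outsideF _ (inl (u, v)) oy isT)]; rewrite iv.
- by have := outsideF (isT : inc (inr (inl v)) o2) s2; rewrite iv.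
- by case/orP: s1 => [/(@outsideF _ (inr (inr tt)) o1 isT)|/(@outsideF _ (inr (inr tt)) oy isT)].
Qed.

Lemma slack0_h (S : {set ocls}) : o1 \in S -> oh \in S -> slack S = 0.
Proof.
move=> s1 sh; apply/eqP; rewrite -leqn0.
apply: (@leq_trans (#|(set0 : {set V * V})| + a * #|(set0 : {set V})|)); last first.
  by rewrite !cards0 muln0.
apply: qcount_bound => [u v iv|v iv|].
- by have := outsideF (isT : inc (inl (u, v)) o1) s1; rewrite iv.
- by have := outsideF (isT : inc (inr (inl v)) oh) sh; rewrite iv.
- by have := outsideF (isT : inc (inr (inr tt)) o1) s1.
Qed.

Lemma slack_o1 (S : {set ocls}) : o1 \in S -> slack S <= a * (#|V| - #|uset S|).
Proof.
move=> s1.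
have -> : a * (#|V| - #|uset S|) = #|(set0 : {set V * V})| + a * #|~: uset S|.
  by rewrite cards0 add0n [#|~: _|]cardsCs setCK.
apply: qcount_bound => [u v iv|v iv|].
- by have := outsideF (isT : inc (inl (u, v)) o1) s1; rewrite iv.
- by rewrite !inE (outsideW iv) //= eqxx.
- by have := outsideF (isT : inc (inr (inr tt)) o1) s1.
Qed.

Lemma slack_o2 (S : {set ocls}) : o2 \in S -> oh \in S -> slack S <= epairs (~: uset S).
Proof.
move=> s2 sh.
rewrite -[epairs _]addn0 -[X in _ + X](muln0 a) -(@cards0 V).
apply: qcount_bound => [u v iv e|v iv|].
- by rewrite !inE e !(outsideW iv) //= eqxx ?orbT.
- by have := outsideF (isT : inc (inr (inl v)) o2) s2; rewrite iv.
- by have := outsideF (isT : inc (inr (inr tt)) oh) sh.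
Qed.

Lemma osum_ge (S : {set ocls}) o : o \in S -> wt (inl o) <= osum S.
Proof. by move=> oS; rewrite /osum (bigD1 o) //= leq_addr. Qed.

Lemma osum_ge2 (S : {set ocls}) o o' : o \in S -> o' \in S -> o != o' ->
  wt (inl o) + wt (inl o') <= osum S.
Proof.
move=> oS oS' no; rewrite /osum (bigD1 o) //= (bigD1 o') /= ?addnA ?leq_addr //.
by rewrite oS' eq_sym.
Qed.

Lemma uset_new (S S' : {set ocls}) : #|uset S| < #|uset S'| ->
  L <= osum (S' :\: S).
Proof.
move=> lt; have [v vS' vS] : exists2 v, v \in uset S' & v \notin uset S.
  apply/subsetPn; apply: contraL lt => /subset_leq_card; by rewrite -leqNgt.
rewrite -(wO (o := inl v)) //; apply: osum_ge.
by move: vS' vS; rewrite !inE => -> ->.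
Qed.

(** The inequality is the budget of a round in which part of Q burns: the new classes are paid for
    by clique vertices that are clean already or have no neighbour in [S']. *)
Lemma inv_step (S S' : {set ocls}) : clean_inv S -> ~~ (S' \subset S) ->
  osum (S' :\: S) <= slack S' + gain S -> clean_inv S'.
Proof.
move=> iS /subsetPn[o oS' oS] le.
(* Without slack a new class would have to be paid for by gain alone. This gives all exclusions
   between the special classes. *)
have new0 : slack S' = 0 -> False.
  move=> s0; have oD : o \in S' :\: S by rewrite inE oS.
  by have := gain_lt iS oS; have := osum_ge oD; lia.
have I1 : o2 \in S' -> o1 \notin S' /\ oy \notin S'.
  move=> s2; apply/andP; rewrite -negb_or; apply/negP=> s1.
  exact/new0/slack0_o2.
split=> // [s1 sy|s2 sh].
  have h : oh \notin S' by apply/negP => sh; exact/new0/slack0_h.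
  split=> //; rewrite leqNgt; apply/negP => kU.
  have s' : slack S' + a <= L.
    apply: (@leq_trans (a * (#|V| - k.+1) + a)).
      rewrite leq_add2r; apply: leq_trans (slack_o1 s1) _.
      by rewrite leq_mul2l leq_sub2l ?orbT.
    by rewrite LE -mulnSr leq_mul2l; apply/orP; right; lia.
  (* Coming from the side of [o2], both [o1] and [oy] are new and cost twice [L], against at most
     twice [L - a]. For a single class of weight [L] this comparison would prove nothing; hence the
     twin. *)
  case o2S: (o2 \in S).
    have [] : o1 \notin S /\ oy \notin S by case: iS => /(_ o2S).
    move=> n1 ny; have := gain_L_lt iS o2S.
    have := @osum_ge2 (S' :\: S) o1 oy.
    rewrite !inE s1 sy n1 ny !wO // => /(_ isT isT isT); lia.
  have gc := gain_c_lt iS (negbT o2S).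
  case A: ((o1 \in S) && (oy \in S)).
    case/andP: A => t1 ty; have [_ uk] : oh \notin S /\ #|uset S| <= k by case: iS => _ /(_ t1 ty).
    have := uset_new (leq_ltn_trans uk kU); lia.
  have := gain_o1 iS (negbT o2S); rewrite A leqn0 => /eqP g0.
  have : L <= osum (S' :\: S).
    move/negbT: A; rewrite negb_and => /orP[n1|ny].
      by rewrite -(wO (o := o1)) //; apply: osum_ge; rewrite inE n1.
    by rewrite -(wO (o := oy)) //; apply: osum_ge; rewrite inE ny.
  lia.
rewrite ltnNge; apply/negP => kU.
(* The slack is carried by pairs in the complement of [uset S'], which has at most k points, so
   [few] applies to the complement. *)
have sc : slack S' < c.
  apply: leq_ltn_trans (slack_o2 s2 sh) _; apply: few.
  by rewrite cardsCs setCK; lia.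
case o2S: (o2 \in S); last first.
  have := gain_c_lt iS (negbT o2S).
  have : wt (inl o2) <= osum (S' :\: S) by apply: osum_ge; rewrite inE o2S.
  rewrite wO //; lia.
case hS: (oh \in S).
  have uk : #|uset S| < #|V| - k by case: iS => _ _ /(_ o2S hS).
  have := uset_new (leq_trans uk kU); have := gain_L_lt iS o2S; lia.
(* Without [oh] in [S] there is no gain, and a slack below [c] cannot pay for [oh]. *)
have := gain_o2 iS o2S; rewrite hS leqn0 => /eqP g0.
have : wt (inl oh) <= osum (S' :\: S) by apply: osum_ge; rewrite inE hS.
rewrite wh; lia.
Qed.


Lemma cost_ge (T : {set ocls}) (P : pred qcls) (A : {set X}) :
  overts T \subset A -> qset P \subset A -> osum T + qcount P <= #|A|.
Proof.
move=> TA PA; rewrite -osumE -cardsUI.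
suff -> : overts T :&: [set x | if cl x is inr q then P q else false] = set0.
  by rewrite cards0 addn0 subset_leq_card // subUset TA.
by apply/setP=> x; rewrite !inE; case: (cl x) => [o|q] //; rewrite andbF.
Qed.

Lemma qcount_cover (P Q : pred qcls) :
  m <= qcount P + qcount Q + qcount (fun q => ~~ P q && ~~ Q q).
Proof.
rewrite -addnA -(qcountC P) leq_add2l /qcount.
apply: leq_trans (leq_card_setU _ _).
apply: subset_leq_card; apply/subsetP => x; rewrite !inE.
by case: (cl x) => //= q ->; case: (Q q).
Qed.

Lemma clean_step (C A : {set X}) S : clean_inv S -> C \subset full S -> #|A| <= m ->
  exists2 S', clean_inv S' & core G (C :|: A) \subset full S'.
Proof.
move=> iS CS Am; set Y := C :|: A.
have inA x : x \in Y -> x \notin full S -> x \in A.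
  rewrite inE => /orP[/(subsetP CS)->//|//].
have [qY|/subsetPn[x0 x0q x0Y]] := boolP (qv \subset Y).
  exists S => //.
  (* Filling a class outside [S] while Q is covered costs its weight plus m - [gain S], which
     exceeds m by [gain_lt]. *)
  have oY o : oset o \subset Y -> o \in S.
    move=> /subsetP oY; apply: contraT => oS; have gl := gain_lt iS oS.
    have := @cost_ge [set o] (fun q => ~~ inside S q && ~~ inside S q) A.
    rewrite /osum big_set1; have := qcount_cover (inside S) (inside S).
    set N := qcount (fun q => _ && _).
    have -> : overts [set o] \subset A.
      apply/subsetP=> x; rewrite !inE; case xo: (cl x) => [o'|//]; rewrite inE => /eqP o'o.
      by apply: inA; rewrite ?oY ?inE ?xo ?o'o ?eqxx // orbF.
    have -> : qset (fun q => ~~ inside S q && ~~ inside S q) \subset A.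
      apply/subsetP=> x; rewrite !inE; case xq: (cl x) => [//|q] /andP[qS _].
      by apply: inA; rewrite ?(subsetP qY) ?inE ?xq.
    move=> Nm /(_ isT isT); have := qcountC (inside S).
    have -> : qcount (predC (inside S)) = N by apply: eq_card => x; rewrite !inE; case: (cl x) => //= q; rewrite andbb.
    move: gl Am; rewrite /gain; lia.
  apply/subsetP=> x /core_clsP xc; rewrite !inE; case xE: (cl x) xc => [o|q] xc.
    rewrite orbF; apply: oY; apply/subsetP=> y; rewrite inE => /eqP yo.
    by apply: xc; rewrite yo link_refl.
  apply/forallP=> o; apply/implyP=> io; apply: oY; apply/subsetP=> y; rewrite inE => /eqP yo.
  by apply: xc; rewrite yo.
(* The clique vertex [x0] is neither clean nor protected and is adjacent to all of Q, so no clique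
   vertex stays clean. *)
have noq x : x \in core G Y -> if cl x is inl _ then true else false.
  move=> /core_clsP /(_ x0); move: x0q; rewrite !inE; case: (cl x0) => // q _.
  by case: (cl x) => // q' /(_ isT); move: x0Y; rewrite inE => /negPf->.
pose S' := [set o | [exists x in core G Y, cl x == inl o]].
have cS' : core G Y \subset full S'.
  apply/subsetP=> x xc; have := noq x xc; rewrite !inE; case xE: (cl x) => [o|//] _.
  by rewrite orbF inE; apply/existsP; exists x; rewrite xc xE eqxx.
have [SS|nSS] := boolP (S' \subset S).
  exists S => //; apply/subsetP => x xc; have := noq x xc; move: (subsetP cS' x xc).
  by rewrite !inE; case xE: (cl x) => [o|//]; rewrite !orbF => /(subsetP SS) ->.
exists S' => //; apply: (inv_step iS nSS).
have := @cost_ge (S' :\: S) (fun q => ~~ outside S' q && ~~ inside S q) A.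
have -> : overts (S' :\: S) \subset A.
  apply/subsetP=> x; rewrite !inE; case xE: (cl x) => [o|//]; rewrite !inE.
  case/andP=> oS /existsP[y /andP[/core_clsP yc /eqP yo]].
  by apply: inA; [apply: yc; rewrite xE yo link_refl | rewrite !inE xE orbF].
have -> : qset (fun q => ~~ outside S' q && ~~ inside S q) \subset A.
  apply/subsetP=> x; rewrite !inE; case xE: (cl x) => [//|q] /andP[qO qS].
  apply: inA; last by rewrite !inE xE.
  case/forallPn: qO => o; rewrite negb_imply negbK => /andP[io].
  by rewrite inE => /existsP[y /andP[/core_clsP yc /eqP yo]]; apply: yc; rewrite xE yo.
move=> /(_ isT isT) h1; have h2 := leq_trans h1 Am.
by have := leq_trans h2 (qcount_cover (outside S') (inside S)); rewrite leq_add2r.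
Qed.

Lemma necessity : clears G m setT -> False.
Proof.
case=> F [sF]; rewrite subTset => /eqP FT.
have [S iS] : exists2 S, clean_inv S & ~: burning G F (size F) \subset full S.
  apply: (@clean_invariant X G m (fun C => exists2 S, clean_inv S & C \subset full S)) => //.
    by exists set0; rewrite ?sub0set //; split; rewrite inE.
  move=> C A [S iS CS] Am; exact: clean_step iS CS Am.
rewrite FT => /subsetP sub.
(* Every class of the independent part is inhabited, so a win would put [o1] and [o2] into [S]
   together. *)
have oS o : o \in S.
  have : 0 < #|oset o| by apply: leq_trans (wt_ge o).
  case/card_gt0P=> x; rewrite inE => /eqP xo.
  by have := sub x (in_setT _); rewrite !inE xo orbF.
by case: iS => /(_ (oS _))[]; rewrite oS.
Qed.
End Necessity.

Theorem gadget :
  winnable G m <-> exists2 U : {set V}, #|U| <= k & c <= epairs U.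
Proof.
have m0 : 0 < m.
  rewrite (@leq_trans (qcount (fun q => q == inr (inr tt)))) //; last first.
    by rewrite -(qcountC (fun q => q == inr (inr tt))) leq_addr.
  rewrite qcount_sum big_pred1_eq; apply: leq_trans wQ; lia.
rewrite winnable_clears //; split=> [cT|[U Uk Uc]]; last exact: sufficiency Uk Uc.
apply: contrapT => no; apply: necessity cT => U Uk.
by rewrite ltnNge; apply/negP => cU; apply: no; exists U.
Qed.
End Gadget.

(** * Traces of a nondeterministic machine *)

(** The cell at signed distance [k] from the head: a move becomes a shift of the index. *)
Definition tget A (x : tape A) (k : int) : sym A :=
  let: (l, a, r) := x in
  match k with
  | Posz 0 => a
  | Posz k'.+1 => nth None r k'
  | Negz k' => nth None l k'
  end.

Definition delta (d : move) : int :=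
  match d with MoveL => (-1)%R | MoveS => 0%R | MoveR => 1%R end.

Lemma tget_write_move A (y : sym A * move) (x : tape A) (k : int) :
  tget (write_move y x) k =
  if (k + delta y.2 == 0)%R then y.1 else tget x (k + delta y.2)%R.
Proof.
case: y x => b [] [[l a] r] /=.
- by case: k => [[|[|k]]|k] /=; rewrite ?nth_behead ?addn0 //; case: l.
- by rewrite GRing.addr0; case: k => [[|k]|k].
- case: k => [[|k]|[|k]] /=; rewrite ?nth_behead ?addn1 ?subn1 //.
Qed.

Section Traces.
Variables (M : TM) (w : seq bool).
Local Notation tp := 'I_(extra M).+1.

Definition tab :=
  ((state M * {ffun tp -> sym (aux M)}) *
   (state M * {ffun tp -> sym (aux M) * move}))%type.
HB.instance Definition _ := Finite.on tab.

Implicit Types z : tab.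
Definition st z := z.1.1.
Definition rd z := z.1.2.
Definition nx z := z.2.1.
Definition wr z (i : tp) := (z.2.2 i).1.
Definition mv z (i : tp) := (z.2.2 i).2.
Definition idle q (r : {ffun tp -> sym (aux M)}) : tab :=
  ((q, r), (q, [ffun i => (r i, MoveS)])).
(** Idling is allowed once no transition applies, so an accepting run can be stretched to any
    prescribed number of time steps. *)
Definition legal z := (z.2 \in trans (st z) (rd z)) ||
  ((trans (st z) (rd z) == set0) && (z == idle (st z) (rd z))).
Definition haltacc z := (trans (st z) (rd z) == set0) && (st z \in accepting M).

Definition movepos (d : move) (p p' : nat) : bool :=
  match d with MoveL => p == p'.+1 | MoveS => p' == p | MoveR => p' == p.+1 end.

Variable (P0 : nat).
(** Every head starts on cell [P0]. With [P0] at least the running time no head gets below cell 0,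
    and positions can be natural numbers. *)
Definition ini (i : tp) (p : nat) : sym (aux M) :=
  if [&& i == ord0, P0 <= p & p < P0 + size w]
  then Some (inl (nth false w (p - P0))) else None.

Variables (zt : nat -> tab) (pos : nat -> tp -> nat).

Fixpoint cont t (i : tp) (p : nat) : sym (aux M) :=
  if t is t'.+1 then if p == pos t' i then wr (zt t') i else cont t' i p
  else ini i p.

Lemma cont_none t i p : (forall s, s < t -> pos s i <> p) -> cont t i p = ini i p.
Proof.
elim: t => //= t IH H; case: eqP => [e|_]; first by case: (H t).
by apply: IH => s st; apply: H; apply: ltnW.
Qed.

Lemma cont_last s t i p : s < t -> pos s i = p ->
  (forall s', s < s' < t -> pos s' i <> p) -> cont t i p = wr (zt s) i.
Proof.
elim: t => //= t IH; rewrite ltnS leq_eqVlt => /orP[/eqP<-{t IH} ->|lt e H].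
  by rewrite eqxx.
case: eqP => [e'|_]; first by case: (H t); rewrite ?lt ?ltnSn.
by apply: IH => // s' /andP[h1 h2]; apply: H; rewrite h1 ltnW.
Qed.

Definition located (c : config M) t :=
  forall i p, tget (c.2 i) (Posz p - Posz (pos t i))%R = cont t i p.

Lemma located_init : (forall i, pos 0 i = P0) -> located (init M w) 0.
Proof.
move=> p0 i p; rewrite /init /= ffunE p0 /ini.
have -> : (if [&& i == ord0, P0 <= p & p < P0 + size w]
   then Some (inl (nth false w (p - P0))) else None : sym (aux M)) =
   if P0 <= p then nth None [seq Some (inl b) : sym (aux M) | b <- (if i == ord0 then w else [::])] (p - P0) else None.
  case: (i == ord0) => /=; last by rewrite nth_nil; case: ifP.
  case: (leqP P0 p) => //= Pp.
  have [lt|ge] := ltnP p (P0 + size w); first by rewrite (nth_map false) //; lia.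
  by rewrite nth_default // size_map; lia.
set s := [seq _ | _ <- _]; rewrite /input_tape -/s.
case: leqP => Pp.
  have -> : (Posz p - Posz P0 = Posz (p - P0))%R by lia.
  case: (p - P0) => [|k] /=; first by rewrite nth0.
  by rewrite nth_behead.
have -> : (Posz p - Posz P0 = Negz (P0 - p).-1)%R by lia.
by rewrite /= nth_nil.
Qed.

Definition fire (c : config M) z : config M :=
  (nx z, [ffun i => write_move (z.2.2 i) (c.2 i)]).

Lemma located_fire c t : located c t ->
  (forall i, movepos (mv (zt t) i) (pos t i) (pos t.+1 i)) ->
  located (fire c (zt t)) t.+1.
Proof.
move=> lc mp i p; rewrite /fire /= ffunE tget_write_move.
have -> : (Posz p - Posz (pos t.+1 i) + delta ((zt t).2.2 i).2 =
           Posz p - Posz (pos t i))%R.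
  have := mp i; rewrite /mv; case: (_.2) => /= /eqP; lia.
rewrite lc; have -> : (Posz p - Posz (pos t i) == 0)%R = (p == pos t i) by lia.
by [].
Qed.

Definition reads (c : config M) : {ffun tp -> sym (aux M)} := [ffun i => (c.2 i).1.2].

Lemma located_reads c t i : located c t -> reads c i = cont t i (pos t i).
Proof.
move=> lc; rewrite -lc GRing.subrr ffunE.
by case: (c.2 i) => [[l a] r].
Qed.

Lemma fire_idle c : fire c (idle c.1 (reads c)) = c.
Proof.
case: c => q x; rewrite /fire /=; congr (_, _); apply/ffunP=> i.
by rewrite !ffunE /=; case: (x i) => [[l a] r].
Qed.

Lemma steps_rcons n (c d e : config M) : steps n c d -> step d e -> steps n.+1 c e.
Proof.
elim: n c => [|n IH] c /=; first by move=> <- de; exists e.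
by case=> c' cc' /IH H /H; exists c'.
Qed.

(* [lv t i] is 0 if head i reads a cell for the first time at time t, and s.+1
   if the last visit of that cell was at time s. *)
Definition consistent B (lv : nat -> tp -> nat) :=
  (forall t, t < B -> [/\ legal (zt t), t = 0 -> st (zt t) = start M /\ (forall i, pos t i = P0),
     t.+1 = B -> haltacc (zt t) &
     forall i, lv t i <= t /\ (lv t i = 0 -> rd (zt t) i = ini i (pos t i))]) /\
  (forall s t, s < t -> t < B ->
     (forall i, [/\ lv t i = s.+1 -> pos s i = pos t i /\ wr (zt s) i = rd (zt t) i,
        lv t i <= s -> pos s i <> pos t i &
        t = s.+1 -> movepos (mv (zt s) i) (pos s i) (pos t i)]) /\
     (t = s.+1 -> nx (zt s) = st (zt t))).

(** The pairwise conditions force [lv] to name the true last visit, so each symbol read is the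
    current content of its cell, and the guessed steps can be replayed on the machine. *)
Lemma consistent_accepts B lv : 0 < B -> consistent B lv -> accepts M w.
Proof.
move=> B0 [H1 H2].
have rdE t i : t < B -> rd (zt t) i = cont t i (pos t i).
  move=> tB; have [_ _ _ /(_ i)[lt l0]] := H1 t tB.
  case lE: (lv t i) lt l0 => [|s] lt l0.
    rewrite l0 // cont_none // => s lst; have [/(_ i)[_ + _] _] := H2 s t lst tB.
    by apply; rewrite lE.
  have [/(_ i)[/(_ lE)[pe <-] _ _] _] := H2 s t lt tB.
  rewrite (@cont_last s) // => s' /andP[ss' s't].
  have [/(_ i)[_ + _] _] := H2 s' t s't tB; apply; by rewrite lE.
have main : forall t, t < B -> exists n c, [/\ steps n (init M w) c, c.1 = st (zt t) & located c t].
  elim=> [_|t IH tB].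
    have [_ /(_ erefl)[s0 p0] _ _] := H1 0 B0.
    by exists 0, (init M w); split=> //; apply: located_init.
  have tB' := ltnW tB; have [n [c [sc c1 lc]]] := IH tB'.
  have [mp' nE] := H2 t t.+1 (ltnSn _) tB.
  have mp i : movepos (mv (zt t) i) (pos t i) (pos t.+1 i) by case: (mp' i) => _ _; apply.
  have trace_rel : reads c = rd (zt t) by apply/ffunP => i; rewrite (located_reads _ lc) rdE.
  have lf := located_fire lc mp.
  have [lg _ _ _] := H1 t tB'; case/orP: lg => [tr|/andP[_ /eqP zi]].
    exists n.+1, (fire c (zt t)); split=> //; last by rewrite -nE.
    apply: steps_rcons sc _; exists (zt t).2 => //.
    by rewrite /options -/(reads c) trace_rel c1.
  (* An idle step advances the trace but not the run. *)
  exists n, c; split=> //; first by rewrite -nE // zi c1.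
  move: lf; have -> : fire c (zt t) = c; last by [].
  by rewrite zi -c1 -trace_rel fire_idle.
case: B B0 H1 H2 rdE main => // B _ H1 H2 rdE /(_ B (ltnSn _)) [n [c [sc c1 lc]]].
exists n, c; have [_ _ /(_ erefl)/andP[/eqP h a] _] := H1 B (ltnSn _).
split=> //; last by rewrite c1.
rewrite /halted /options -/(reads c) c1.
have -> : reads c = rd (zt B) by apply/ffunP => i; rewrite (located_reads _ lc) rdE.
by [].
Qed.

End Traces.

(** * From accepting runs to consistent traces *)

Section TraceExistence.
Variables (M : TM) (w : seq bool).
Local Notation tp := 'I_(extra M).+1.

Lemma run_sequence n (c0 c : config M) : steps n c0 c -> halted c ->
  exists (cf : nat -> config M) (zf : nat -> tab M), [/\ cf 0 = c0,
    forall t, [/\ st (zf t) = (cf t).1, rd (zf t) = reads (cf t), legal (zf t)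
                & cf t.+1 = fire (cf t) (zf t)]
    & forall t, n <= t -> zf t = idle c.1 (reads c)].
Proof.
move=> + hc; elim: n c0 => [|n IH] c0 /=.
  move=> ->; exists (fun=> c), (fun=> idle c.1 (reads c)); split=> // t; split=> //.
    apply/orP; right; rewrite /st /rd /= eqxx andbT; exact/eqP.
  by rewrite fire_idle.
case=> d [a ac dE] /IH [cf [zf [cf0 H zE]]].
exists (fun t => if t is t'.+1 then cf t' else c0),
  (fun t => if t is t'.+1 then zf t' else ((c0.1, reads c0), a)).
split=> // [[|t]|[|t]] //=; last by rewrite ltnS; apply: zE.
split=> //; first by rewrite /legal /st /rd /= -/(options c0) ac.
by rewrite cf0 dE.
Qed.

Fixpoint headpos P0 (zf : nat -> tab M) t (i : tp) : nat :=
  if t is t'.+1 then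
    match mv (zf t') i with
    | MoveL => (headpos P0 zf t' i).-1
    | MoveS => headpos P0 zf t' i
    | MoveR => (headpos P0 zf t' i).+1
    end
  else P0.

Lemma accepts_consistent T0 P0 B : accepts M w ->
  (forall n c, steps n (init M w) c -> n <= T0) -> T0 <= P0 -> T0 < B ->
  exists (zt : nat -> tab M) pos lv, consistent w P0 zt pos B lv /\
    forall t i, pos t i <= P0 + T0.
Proof.
case=> n [c [sc hc ac]] /(_ _ _ sc) nT TP TB.
have nP := leq_trans nT TP.
have [cf [zf [cf0 H zE]]] := run_sequence sc hc.
pose pos := headpos P0 zf.
have posb t i : P0 - minn t n <= pos t i <= P0 + minn t n.
  elim: t => [|t IH]; first by rewrite min0n subn0 addn0 /= leqnn.
  rewrite /pos /=; have [lt|le] := ltnP t n.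
    move: IH; rewrite /pos; case: (mv _ _); lia.
  rewrite zE // /mv /= ffunE /=; move: IH; rewrite /pos; lia.
have movep t i : movepos (mv (zf t) i) (pos t i) (pos t.+1 i).
  rewrite /pos /=; case mE: (mv _ _) => //=.
  (* A left move is no idle step, so t < n <= [P0] and the position is positive: the predecessor in
     [headpos] is not truncated. *)
  have : t < n by rewrite ltnNge; apply/negP => /zE zi; move: mE; rewrite zi /mv /= ffunE.
  by have := posb t i; rewrite /pos; lia.
have loc t : located w P0 zf pos (cf t) t.
  elim: t => [|t IH]; first by rewrite cf0; apply: located_init.
  by have [_ _ _ ->] := H t; apply: located_fire.
(* The empty maximum is 0, the code of a first visit. *)
pose lv t i := \max_(s < t | pos s i == pos t i) s.+1.
have rdE t i : rd (zf t) i = cont w P0 zf pos t i (pos t i).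
  by have [_ -> _ _] := H t; apply: located_reads.
have lvge s t i : s < t -> pos s i = pos t i -> s < lv t i.
  move=> lst pe; apply: (@leq_bigmax_cond _ _ (fun j : 'I_t => j.+1) (Ordinal lst)).
  by rewrite /= pe.
have lvex t i : lv t i != 0 -> exists2 s, s < t & pos s i = pos t i /\ lv t i = s.+1.
  rewrite /lv; elim/big_ind: _ => // [x y IHx IHy|s /eqP pe _].
    by rewrite /maxn; case: ifP.
  by exists s.
exists zf, pos, lv; split; last by move=> t i; have := posb t i; lia.
split=> [t tB|s t lst tB].
  have [sE trace_rel lg fE] := H t; split=> //.
  - by move=> t0; split=> [|i]; rewrite ?sE t0 ?cf0.
  - move=> trace_edge; have nt : n <= t by lia.
    rewrite zE //; apply/andP; split=> //; exact/eqP.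
  move=> i; split.
    by apply/bigmax_leqP => -[s lst] _.
  move=> l0; rewrite rdE cont_none // => s lst pe.
  by have := lvge s t i lst pe; rewrite l0.
split=> [i|trace_edge].
  split.
  - move=> lE; have [|s' s't [pe]] := lvex t i; first by rewrite lE.
    rewrite lE => -[sE]; rewrite -sE in pe s't; split=> //.
    rewrite rdE (@cont_last _ _ _ _ _ s) // => s'' /andP[h1 h2] pe'.
    by have := lvge _ _ _ h2 pe'; rewrite lE ltnS leqNgt h1.
  - by move=> le pe; have := lvge _ _ _ lst pe; rewrite ltnNge le.
  - by move=> ->; apply: movep.
by rewrite trace_edge; have [-> _ _ _] := H s.+1; have [_ _ _ ->] := H s.
Qed.

End TraceExistence.

(** * Traces as cliques *)

Section TraceGraph.
Variable M : TM.
Local Notation tp := 'I_(extra M).+1.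
Local Notation K := (extra M).+1.
(** Coordinate 0 is the time and 1 the rank of the local data; a head position and a last visit per
    tape follow. *)
Definition ncoord := (K + K).+2.

Definition cpos (i : tp) := i.+2.
Definition clv (i : tp) := (K + i).+2.

Section Relation.
Variables (P0 END B : nat) (inp : seq bool).

(** [ini] without subtraction: [inp] will be the input behind [P0] padding bits, so that a cell
    number is directly an index. Only comparisons and bit lookups remain. *)
Definition rini (i : tp) (s : sym (aux M)) (p : nat) : bool :=
  match s with
  | None => ~~ [&& i == ord0, P0 <= p & p < END]
  | Some (inl b) => [&& i == ord0, P0 <= p & p < END] && (nth false inp p == b)
  | Some (inr _) => false
  end.

Definition unary_ok (z : tab M) (f : nat -> nat) : bool :=
  [&& legal z,
      (f 0 == 0) ==> (st z == start M) && [forall i, f (cpos i) == P0],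
      ((f 0).+1 == B) ==> haltacc z
    & [forall i, (f (clv i) <= f 0) &&
         ((f (clv i) == 0) ==> rini i (rd z i) (f (cpos i)))]].

Definition binary_ok (z z' : tab M) (f f' : nat -> nat) : bool :=
  [forall i, [&& (f' (clv i) == (f 0).+1) ==>
                    (f (cpos i) == f' (cpos i)) && (wr z i == rd z' i),
                 (f' (clv i) <= f 0) ==> (f (cpos i) != f' (cpos i))
               & (f' 0 == (f 0).+1) ==> movepos (mv z i) (f (cpos i)) (f' (cpos i))]] &&
  ((f' 0 == (f 0).+1) ==> (nx z == st z')).

Definition same (J : nat) (f f' : nat -> nat) := [forall k : 'I_J, f k == f' k].

(** Distinct points of the same time are incompatible, which makes a clique a function of time. An
    admissible point is compatible with itself, so a clique of k points has k^2 ordered pairs, and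
    the conditions on single points are also expressed by pairs. *)
Definition trace_rel (f f' : nat -> nat) : bool :=
  [exists z : tab M, exists z' : tab M,
    [&& f 1 == enum_rank z, f' 1 == enum_rank z', unary_ok z f, unary_ok z' f'
      & [|| same ncoord f f', (f 0 < f' 0) && binary_ok z z' f f'
          | (f' 0 < f 0) && binary_ok z' z f' f]]].
End Relation.

Definition coords J B (v : {ffun 'I_J -> 'I_B}) (k : nat) : nat :=
  if insub k is Some i then v i else 0.

Lemma co_ord J B (v : {ffun 'I_J -> 'I_B}) (i : 'I_J) : coords v i = v i.
Proof. by rewrite /coords valK. Qed.

Lemma same_co J B (v v' : {ffun 'I_J -> 'I_B}) : same J (coords v) (coords v') = (v == v').
Proof.
apply/forallP/eqP => [H|-> k]; last by [].
by apply/ffunP=> i; apply: val_inj; have := H i; rewrite !co_ord => /eqP.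
Qed.

Variables (w : seq bool) (T0 P0 B : nat).
Hypotheses (time : forall n c, steps n (init M w) c -> n <= T0).
Hypotheses (TP : T0 <= P0) (PB : P0 + T0 < B) (zB : #|{: tab M}| <= B).
Let inp := nseq P0 false ++ w.
Let END := P0 + size w.
Local Notation V := {ffun 'I_ncoord -> 'I_B}.
Definition trace_edge : rel V := fun u v => trace_rel P0 END B inp (coords u) (coords v).

Lemma riniE i s p : rini P0 END inp i s p = (s == ini w P0 i p).
Proof.
rewrite /rini /ini -/END.
case: ifP => h; case: s => [[b|x]|] //=.
case/and3P: h => _ h1 h2.
rewrite /inp nth_cat size_nseq ltnNge h1 /= eq_sym.
by apply/eqP/eqP => [->|[]].
Qed.

Lemma B0 : 0 < B. Proof. by apply: leq_trans PB. Qed.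

Lemma accepts_clique :
  accepts M w -> exists2 U : {set V}, #|U| <= B & B * B <= epairs trace_edge U.
Proof.
move=> acc; have TB : T0 < B by lia.
have [zt [pos [lv [[H1 H2] posb]]]] := accepts_consistent acc time TP TB.
pose tr t k := if k == 0 then t else if k == 1 then enum_rank (zt t) : nat
  else if k < K.+2 then pos t (inord (k - 2)) else lv t (inord (k - 2 - K)).
have trp t i : tr t (cpos i) = pos t i.
  rewrite /tr /cpos /=; case: ifP => [_|/negbT]; last by have := ltn_ord i; lia.
  by rewrite !subSS subn0 inord_val.
have trl t i : tr t (clv i) = lv t i.
  rewrite /tr /clv /=; case: ifP => [|_]; first by lia.
  by congr lv; rewrite -[RHS]inord_val; congr inord; lia.
pose vt (t : 'I_B) : V := [ffun k : 'I_ncoord => insubd t (tr t k)].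
have lvb t i : t < B -> lv t i <= t.
  by move=> tB; have [_ _ _ /(_ i)[]] := H1 t tB.
have trb (t : 'I_B) k : tr t k < B.
  rewrite /tr; case: ifP => // _; case: ifP => _; first by apply: leq_trans zB.
  case: ifP => _; first by apply: leq_ltn_trans PB.
  by apply: leq_ltn_trans (lvb _ _ (ltn_ord t)) (ltn_ord t).
have covt (t : 'I_B) k : k < ncoord -> coords (vt t) k = tr t k.
  move=> kJ; rewrite -[k]/(val (Ordinal kJ)) co_ord ffunE insubdK //.
  exact: trb.
have covp t i : coords (vt t) (cpos i) = pos t i.
  by rewrite covt ?trp // /ncoord /cpos; have := ltn_ord i; lia.
have covl t i : coords (vt t) (clv i) = lv t i.
  by rewrite covt ?trl // /ncoord /clv; have := ltn_ord i; lia.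
have cov0 t : coords (vt t) 0 = t by rewrite covt.
have cov1 t : coords (vt t) 1 = enum_rank (zt t) by rewrite covt.
have un (t : 'I_B) : unary_ok P0 END B inp (zt t) (coords (vt t)).
  have [lg i0 ih il] := H1 t (ltn_ord t); apply/and4P; split=> //.
  - apply/implyP; rewrite cov0 => /eqP t0; have [-> p0] := i0 t0; rewrite eqxx /=.
    by apply/forallP=> i; rewrite covp p0.
  - by apply/implyP; rewrite cov0 => /eqP /ih.
  - apply/forallP => i; rewrite covl cov0 covp lvb //=; apply/implyP => /eqP l0.
    by rewrite riniE; apply/eqP; have [_] := il i; apply.
have bin (s t : 'I_B) : s < t -> binary_ok (zt s) (zt t) (coords (vt s)) (coords (vt t)).
  move=> lst; have [Hi Hn] := H2 s t lst (ltn_ord t); apply/andP; split.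
    apply/forallP => i; rewrite !covl !covp !cov0; have [h1 h2 h3] := Hi i.
    apply/and3P; split; apply/implyP.
    - by move/eqP/h1 => [-> ->]; rewrite !eqxx.
    - by move/h2/eqP.
    - by move/eqP/h3.
  by rewrite !cov0; apply/implyP => /eqP/Hn->.
have tEE s t : trace_edge (vt s) (vt t).
  apply/existsP; exists (zt s); apply/existsP; exists (zt t).
  rewrite !cov1 !eqxx !un /= !cov0 same_co.
  have [lt|gt|/val_inj->] := ltngtP s t; last by rewrite eqxx.
    by rewrite (bin _ _ lt) ?orbT.
  by rewrite (bin _ _ gt) ?orbT.
have vt_inj : injective vt.
  by move=> s t e; apply: val_inj; rewrite /= -(cov0 s) e cov0.
exists (vt @: setT); first by rewrite (leq_trans (leq_imset_card _ _)) // cardsT card_ord.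
have -> : B * B = #|setX (vt @: setT) (vt @: setT)|.
  by rewrite cardsX card_imset // cardsT card_ord.
apply: subset_leq_card; apply/subsetP=> -[x y]; rewrite !inE /=.
by case/andP=> /imsetP[s _ ->] /imsetP[t _ ->]; rewrite !imset_f //=.
Qed.

(** The count leaves no choice: there are exactly [B] points, all pairs are compatible, their times
    are distinct, hence every time below [B] occurs exactly once. *)
Lemma clique_accepts (U : {set V}) : #|U| <= B -> B * B <= epairs trace_edge U -> accepts M w.
Proof.
move=> UB cU.
have sub : [set p : V * V | [&& p.1 \in U, p.2 \in U & trace_edge p.1 p.2]] \subset setX U U.
  by apply/subsetP => -[x y]; rewrite !inE /= => /and3P[-> ->].
have UU : #|U| * #|U| <= B * B by rewrite leq_mul.
have cB : #|U| = B.
  have := leq_trans cU (subset_leq_card sub); rewrite cardsX.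
  move=> h; apply/eqP; rewrite eqn_leq UB /=.
  by rewrite leqNgt; apply/negP => lt; have := ltn_mul lt lt; rewrite ltnNge h.
have tEU u v : u \in U -> v \in U -> trace_edge u v.
  move=> uU vU; have : (u, v) \in setX U U by rewrite inE /= uU vU.
  have /eqP <- : [set p : V * V | [&& p.1 \in U, p.2 \in U & trace_edge p.1 p.2]] == setX U U.
    by rewrite eqEcard sub cardsX cB.
  by rewrite inE /= => /and3P[].
have tinj u v : u \in U -> v \in U -> coords u 0 = coords v 0 -> u = v.
  move=> uU vU e; have /existsP[z /existsP[z' /and5P[_ _ _ _]]] := tEU u v uU vU.
  by rewrite same_co e ltnn /= orbF => /eqP.
pose i0 : 'I_ncoord := ord0.
have imT : [set (v : V) i0 | v in U] = setT.
  apply/eqP; rewrite eqEcard subsetT cardsT card_ord card_in_imset ?cB //=.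
  by move=> u v uU vU e; apply: tinj => //; rewrite -[0]/(val i0) !co_ord e.
have sgex t : t < B -> exists v, (v \in U) && (coords v 0 == t).
  move=> tB; have : Ordinal tB \in [set (v : V) i0 | v in U] by rewrite imT inE.
  by case/imsetP => v vU e; exists v; rewrite vU -[0]/(val i0) co_ord -e /= eqxx.
have [v0 _] := sgex 0 B0.
pose sg t : V := odflt v0 [pick v | (v \in U) && (coords v 0 == t)].
have sgP t : t < B -> sg t \in U /\ coords (sg t) 0 = t.
  move/sgex => [v vP]; rewrite /sg; case: pickP => [v' /andP[? /eqP ?]//|/(_ v)].
  by rewrite vP.
pose z0 : tab M := idle (start M) [ffun=> None].
pose zt t := odflt z0 [pick z : tab M | coords (sg t) 1 == enum_rank z].
have ztP t z : coords (sg t) 1 == enum_rank z -> z = zt t.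
  move=> zE; rewrite /zt; case: pickP => [z' /eqP e|/(_ z)]; last by rewrite zE.
  by apply: enum_rank_inj; apply: val_inj; rewrite /= -e; apply/esym/eqP.
pose pos t i := coords (sg t) (cpos i); pose lv t i := coords (sg t) (clv i).
apply: (@consistent_accepts M w P0 zt pos B lv B0).
split=> [t tB|s t lst tB].
  have [tU t0] := sgP t tB.
  have /existsP[z /existsP[z' /and5P[/ztP-> _ /and4P[lg h0 hh hl] _ _]]] := tEU _ _ tU tU.
  rewrite t0 in h0 hh hl; split=> //.
  - move=> tE0; have /(implyP h0)/andP[/eqP sE /forallP hp] : t == 0 by rewrite tE0.
    by split=> // i; apply/eqP/hp.
  - by move=> tE1; apply: (implyP hh); rewrite tE1.
  - move=> i; have /andP[h1 h2] := forallP hl i; split=> // l0.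
    by apply/eqP; rewrite -riniE; apply: (implyP h2); rewrite -/(lv t i) l0.
have sB := ltn_trans lst tB; have [sU s0] := sgP s sB; have [tU t0] := sgP t tB.
have /existsP[z /existsP[z' /and5P[/ztP-> /ztP-> _ _]]] := tEU _ _ sU tU.
have ->/= : same ncoord (coords (sg s)) (coords (sg t)) = false.
  apply/negP => /forallP/(_ i0); rewrite -[nat_of_ord i0]/0 s0 t0.
  by move/eqP=> e; move: lst; rewrite e ltnn.
rewrite s0 t0 lst [t < s]ltnNge (ltnW lst) /= orbF => /andP[/forallP bi bn].
rewrite s0 t0 in bn; split=> [i|tE1]; last by apply/eqP; apply: (implyP bn); rewrite tE1.
have /and3P[] := bi i; rewrite s0 t0 => b1 b2 b3; split.
- move=> lE; have := implyP b1; rewrite -/(lv t i) lE eqxx => /(_ isT)/andP[/eqP e /eqP ->].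
  by [].
- by move=> le; apply/eqP; apply: (implyP b2).
- by move=> e; apply: (implyP b3); rewrite e.
Qed.

End TraceGraph.

(** * Stack programs and their compilation *)

Definition store := nat -> seq bool.
Definition upd (s : store) r v : store := fun r' => if r' == r then v else s r'.

Inductive com :=
| Skip
| Push (r : nat) (b : bool)
| Pop (r : nat)
| Seq (c d : com)
| If (r : nat) (p : option bool -> bool) (c d : com)
| While (r : nat) (p : option bool -> bool) (c : com).

(* The last argument counts the machine steps of the compiled program. *)
Inductive exec : com -> store -> store -> nat -> Prop :=
| ESkip s : exec Skip s s 0
| EPush s r b : exec (Push r b) s (upd s r (b :: s r)) 2
| EPop s r : exec (Pop r) s (upd s r (behead (s r))) 1
| ESeq c d s s' s'' n n' : exec c s s' n -> exec d s' s'' n' ->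
    exec (Seq c d) s s'' (n + n')
| EIfT r (p : option bool -> bool) c d s s' n : p (ohead (s r)) -> exec c s s' n ->
    exec (If r p c d) s s' (n + 1).+1
| EIfF r (p : option bool -> bool) c d s s' n : ~~ p (ohead (s r)) -> exec d s s' n ->
    exec (If r p c d) s s' n.+1
| EWhileF r (p : option bool -> bool) c s : ~~ p (ohead (s r)) ->
    exec (While r p c) s s 1
| EWhileT r (p : option bool -> bool) c s s' s'' n n' : p (ohead (s r)) -> exec c s s' n ->
    exec (While r p c) s' s'' n' -> exec (While r p c) s s'' (n + n'.+1).+1.

(** A machine step writes before it moves. A pop, blank and then right, is thus one step, while a
    push must move left first and write in a second step. *)
Inductive instr :=
| ILeft (r : nat)
| IPut (r : nat) (b : bool)
| IPop (r : nat)
| IJmp (r : nat) (p : option bool -> bool) (t : nat).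

Fixpoint csize c :=
  match c with
  | Skip => 0
  | Push _ _ => 2
  | Pop _ => 1
  | Seq c d => csize c + csize d
  | If _ _ c d => (csize c + (csize d).+1).+1
  | While _ _ c => (csize c + 1).+1
  end.

Fixpoint maxreg c :=
  match c with
  | Skip => 0
  | Push r _ | Pop r => r
  | Seq c d => maxn (maxreg c) (maxreg d)
  | If r _ c d => maxn r (maxn (maxreg c) (maxreg d))
  | While r _ c => maxn r (maxreg c)
  end.

Definition njump r (p : option bool -> bool) := IJmp r (fun x => ~~ p x).
Definition goto := IJmp 0 (fun=> true).

(** Jump targets are absolute; [o] is the address of the first instruction. *)
Fixpoint compile o c : seq instr :=
  match c with
  | Skip => [::]
  | Push r b => [:: ILeft r; IPut r b]
  | Pop r => [:: IPop r]
  | Seq c d => compile o c ++ compile (o + csize c) d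
  | If r p c d =>
      njump r p (o + csize c).+2 :: compile o.+1 c ++
      goto (o + csize c + csize d).+2 :: compile (o + csize c).+2 d
  | While r p c => njump r p (o + csize c).+2 :: compile o.+1 c ++ [:: goto o]
  end.

Lemma size_comp o c : size (compile o c) = csize c.
Proof.
elim: c o => //= [c IHc d IHd|r p c IHc d IHd|r p c IHc] o.
- by rewrite size_cat IHc IHd.
- by rewrite size_cat /= IHc IHd.
- by rewrite size_cat /= IHc.
Qed.

(** * Simulation of stack programs by a Turing machine *)

Section Machine.
Variables (K : nat) (code : seq instr).
Local Notation vsym := (sym void).
Local Notation tp := 'I_K.+1.
Definition bit_of (x : vsym) : option bool := if x is Some (inl b) then Some b else None.
Definition sym_of (b : bool) : vsym := Some (inl b).

Definition stay (r : {ffun tp -> vsym}) : {ffun tp -> vsym * move} :=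
  [ffun i => (r i, MoveS)].

Definition iact (pc : nat) (x : instr) (r : {ffun tp -> vsym}) :
    nat * {ffun tp -> vsym * move} :=
  match x with
  | ILeft k => (pc.+1, [ffun i : tp => if i == k :> nat then (r i, MoveL) else (r i, MoveS)])
  | IPut k b => (pc.+1, [ffun i : tp => if i == k :> nat then (sym_of b, MoveS) else (r i, MoveS)])
  | IPop k => (pc.+1, [ffun i : tp => if i == k :> nat then (None, MoveR) else (r i, MoveS)])
  | IJmp k p t => (if p (bit_of (r (inord k))) then t else pc.+1, stay r)
  end.

Definition vtrans (q : 'I_(size code).+1) (r : {ffun tp -> vsym}) :
    {set 'I_(size code).+1 * {ffun tp -> vsym * move}} :=
  if q < size code then
    let x := iact q (nth (goto 0) code q) r in [set (inord x.1, x.2)]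
  else set0.

Definition machine : TM := @MkTM K void 'I_(size code).+1 ord0 set0 vtrans.

Lemma machine_deterministic : deterministic machine.
Proof. by move=> q r; rewrite /= /vtrans; case: ifP; rewrite ?cards1 ?cards0. Qed.

(** The top of the stack is under the head. Input and output tapes have this form already. The
    comparison is cell by cell because popping leaves explicit blanks behind. *)
Definition rep (x : tape void) (s : seq bool) :=
  let: (l, a, r) := x in
  (forall i, nth None l i = None) /\
  (forall i, nth None (a :: r) i = nth None (map sym_of s) i).

Definition reps (x : {ffun tp -> tape void}) (s : store) := forall i : tp, rep (x i) (s i).

Definition cfg (pc : nat) (x : {ffun tp -> tape void}) : config machine := (inord pc, x).

Definition top (x : {ffun tp -> tape void}) : {ffun tp -> vsym} := [ffun i => (x i).1.2].

Lemma machine_step pc x : pc < size code ->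
  let a := iact pc (nth (goto 0) code pc) (top x) in
  step (cfg pc x) (cfg a.1 [ffun i => write_move (a.2 i) (x i)]).
Proof.
move=> lt a; exists (inord a.1, a.2) => //.
rewrite /options /= /vtrans inordK ?lt; last exact: ltnW.
by rewrite in_set1 /a.
Qed.

Lemma steps_cat (M : TM) n n' (c d e : config M) :
  steps n c d -> steps n' d e -> steps (n + n') c e.
Proof. by elim: n c => [c -> //|n IH c [c' cc' /IH H] /H]; exists c'. Qed.

Lemma write_stay (x : tape void) : write_move (x.1.2, MoveS) x = x.
Proof. by case: x => [[l a] r]. Qed.

Lemma rep_top x s : rep x s -> bit_of x.1.2 = ohead s.
Proof. by case: x => [[l a] r] [_ /(_ 0)] /= ->; case: s. Qed.

Lemma step_jmp pc x k p t : pc < size code -> nth (goto 0) code pc = IJmp k p t ->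
  step (cfg pc x) (cfg (if p (bit_of (x (inord k)).1.2) then t else pc.+1) x).
Proof.
move=> lt e; have := machine_step x lt; rewrite e /= ffunE.
suff -> : [ffun i => write_move (stay (top x) i) (x i)] = x by [].
by apply/ffunP => i; rewrite !ffunE write_stay.
Qed.

Lemma step_push pc x s k b : pc.+1 < size code ->
  nth (goto 0) code pc = ILeft k -> nth (goto 0) code pc.+1 = IPut k b ->
  reps x s -> exists2 x', reps x' (upd s k (b :: s k)) & steps 2 (cfg pc x) (cfg pc.+2 x').
Proof.
move=> lt e1 e2 xs; have := machine_step x (ltnW lt); rewrite e1 /=.
set x1 := [ffun i => _] => st1.
have := machine_step x1 lt; rewrite e2 /=; set x2 := [ffun i => _] => st2.
exists x2; last by exists (cfg pc.+1 x1) => //; exists (cfg pc.+2 x2).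
move=> i; rewrite /x2 ffunE ffunE /upd; have := xs i.
rewrite /x1 !ffunE; case: eqP => [e|_]; last by case: (x i) => [[l a] r].
rewrite -e; case: (x i) => [[l a] r] [hl hr] /=; split=> [j|[|j]] //=.
by rewrite nth_behead hl.
Qed.

Lemma step_pop pc x s k : pc < size code -> nth (goto 0) code pc = IPop k ->
  reps x s -> exists2 x', reps x' (upd s k (behead (s k))) & step (cfg pc x) (cfg pc.+1 x').
Proof.
move=> lt e1 xs; have := machine_step x lt; rewrite e1 /=.
set x1 := [ffun i => _] => st1; exists x1 => // i.
have := xs i; rewrite /x1 !ffunE /upd; case: eqP => [e|nonempty]; rewrite ?e; last first.
  by rewrite write_stay.
case: (x i) => [[l a] r] [hl hr] /=; split=> [[|j]|j] //=.
have -> : nth None (head None r :: behead r) j = nth None r j by case: r {hr} => [|? ?]; case: j => //= j; rewrite nth_nil.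
by rewrite -[nth None r j]/(nth None (a :: r) j.+1) hr; case: (s k) => //=; rewrite nth_nil.
Qed.

(** Induction on the execution rather than on the program, since a loop runs the same code again;
    the surrounding code must stay arbitrary. *)
Lemma simulation c s s' n : exec c s s' n -> forall pre post x,
  code = pre ++ compile (size pre) c ++ post -> maxreg c <= K -> reps x s ->
  exists2 x', reps x' s' & steps n (cfg (size pre) x) (cfg (size pre + csize c) x').
Proof.
elim=> {c s s' n}.
- by move=> s pre post x _ _ xs; exists x; rewrite ?addn0.
- move=> s r b pre post x grid_edge _ xs; rewrite addn2; apply: step_push xs.
  + by rewrite grid_edge !size_cat /=; lia.
  + by rewrite grid_edge nth_cat ltnn subnn.
  + by rewrite grid_edge nth_cat ltnNge leqnSn /= subSn // subnn.
- move=> s r pre post x grid_edge _ xs; rewrite addn1.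
  have [||x' xs' st] := @step_pop (size pre) x s r _ _ xs.
  + by rewrite grid_edge !size_cat /=; lia.
  + by rewrite grid_edge nth_cat ltnn subnn.
  by exists x' => //; exists (cfg (size pre).+1 x').
- move=> c d s s' s'' n n' _ IHc _ IHd pre post x grid_edge; rewrite /= geq_max => /andP[hc hd] xs.
  have [|x1 xs1 st1] := IHc pre (compile (size pre + csize c) d ++ post) x _ hc xs.
    by rewrite grid_edge /= -!catA.
  have [|x2 xs2 st2] := IHd (pre ++ compile (size pre) c) post x1 _ hd xs1.
    by rewrite size_cat size_comp grid_edge /= -!catA.
  exists x2 => //; apply: steps_cat st1 _; move: st2.
  by rewrite size_cat size_comp addnA.
- move=> r p c d s s' n pr _ IHc pre post x grid_edge; rewrite /= !geq_max => /and3P[hr hc hd] xs.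
  have l0 : size pre < size code by rewrite grid_edge !size_cat /=; lia.
  have e0 : nth (goto 0) code (size pre) = njump r p (size pre + csize c).+2.
    by rewrite grid_edge nth_cat ltnn subnn.
  have := step_jmp x l0 e0.
  rewrite (rep_top (xs (inord r))) inordK // pr /= => st0.
  have [|x1 xs1 st1] := IHc (rcons pre (njump r p (size pre + csize c).+2))
     (goto (size pre + csize c + csize d).+2 :: compile (size pre + csize c).+2 d ++ post) x _ hc xs.
    by rewrite grid_edge /= size_rcons -cats1 -!catA.
  exists x1 => //; exists (cfg (size pre).+1 x) => //; apply: steps_cat.
    by move: st1; rewrite size_rcons; exact.
  have l1 : (size pre).+1 + csize c < size code.
    by rewrite grid_edge !size_cat /= !size_cat /= size_comp; lia.
  have e1 : nth (goto 0) code ((size pre).+1 + csize c) = goto (size pre + csize c + csize d).+2.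
    rewrite grid_edge nth_cat ltnNge addSnnS leq_addr /= addKn /= -catA nth_cat size_comp ltnn subnn.
    by [].
  have := step_jmp x1 l1 e1; rewrite /= => st2.
  exists (cfg (size pre + (csize c + (csize d).+1).+1) x1) => //.
  by have -> : size pre + (csize c + (csize d).+1).+1 = (size pre + csize c + csize d).+2 by lia.
- move=> r p c d s s' n pr _ IHd pre post x grid_edge; rewrite /= !geq_max => /and3P[hr hc hd] xs.
  have l0 : size pre < size code by rewrite grid_edge !size_cat /=; lia.
  have e0 : nth (goto 0) code (size pre) = njump r p (size pre + csize c).+2.
    by rewrite grid_edge nth_cat ltnn subnn.
  have := step_jmp x l0 e0.
  rewrite (rep_top (xs (inord r))) inordK // pr /= => st0.
  have sE : size (pre ++ njump r p (size pre + csize c).+2 :: compile (size pre).+1 c ++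
     [:: goto (size pre + csize c + csize d).+2]) = (size pre + csize c).+2.
    by rewrite !size_cat /= size_cat size_comp /=; lia.
  have [|x1 xs1 st1] := IHd (pre ++ njump r p (size pre + csize c).+2 :: compile (size pre).+1 c ++
     [:: goto (size pre + csize c + csize d).+2]) post x _ hd xs.
    by rewrite sE grid_edge /= -!catA /= -!catA.
  exists x1 => //; exists (cfg (size pre + csize c).+2 x) => //.
  move: st1; rewrite sE.
  by have -> : size pre + (csize c + (csize d).+1).+1 = (size pre + csize c).+2 + csize d by lia.
- move=> r p c s pr pre post x grid_edge; rewrite /= !geq_max => /andP[hr hc] xs.
  have l0 : size pre < size code by rewrite grid_edge !size_cat /=; lia.
  have e0 : nth (goto 0) code (size pre) = njump r p (size pre + csize c).+2.
    by rewrite grid_edge nth_cat ltnn subnn.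
  have := step_jmp x l0 e0.
  rewrite (rep_top (xs (inord r))) inordK // pr /= => st0.
  exists x => //; exists (cfg (size pre + csize c).+2 x) => //.
  by have -> : size pre + (csize c + 1).+1 = (size pre + csize c).+2 by lia.
- move=> r p c s s' s'' n n' pr _ IHc _ IHw pre post x grid_edge hK; move: (hK).
  rewrite /= !geq_max => /andP[hr hc] xs.
  have l0 : size pre < size code by rewrite grid_edge !size_cat /=; lia.
  have e0 : nth (goto 0) code (size pre) = njump r p (size pre + csize c).+2.
    by rewrite grid_edge nth_cat ltnn subnn.
  have := step_jmp x l0 e0.
  rewrite (rep_top (xs (inord r))) inordK // pr /= => st0.
  have [|x1 xs1 st1] := IHc (rcons pre (njump r p (size pre + csize c).+2))
     (goto (size pre) :: post) x _ hc xs.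
    by rewrite grid_edge /= size_rcons -cats1 -!catA.
  have [x2 xs2 st2] := IHw pre post x1 grid_edge hK xs1.
  exists x2 => //; exists (cfg (size pre).+1 x) => //; apply: steps_cat.
    by move: st1; rewrite size_rcons; exact.
  have l1 : (size pre).+1 + csize c < size code.
    by rewrite grid_edge !size_cat /= !size_cat /= size_comp; lia.
  have e1 : nth (goto 0) code ((size pre).+1 + csize c) = goto (size pre).
    rewrite grid_edge nth_cat ltnNge addSnnS leq_addr /= addKn /= -catA nth_cat size_comp ltnn subnn.
    by [].
  by have := step_jmp x1 l1 e1; rewrite /= => st3; exists (cfg (size pre) x1).
Qed.

Lemma rep_output x s : rep x s -> output x = s.
Proof.
case: x => [[l a] r] [_]; rewrite /output; elim: s a r => [|b s IH] a r H.
  by have /= -> := H 0.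
have /= -> := H 0; congr (_ :: _).
case: r H => [|a' r] H; first by have := H 1; case: s {IH H} => [|b' s] //=.
by apply: IH => i; have := H i.+1.
Qed.

End Machine.

(** [poly_time] bounds all partial runs, while the analysis of a program yields one halting run; by
    determinism every partial run is a prefix of it. *)
Lemma steps_halted (M : TM) n n' (c d e : config M) : deterministic M ->
  steps n c d -> halted d -> steps n' c e -> n' <= n.
Proof.
move=> det; elim: n n' c => [|n IH] [|n'] c //=.
  by move=> -> hd [e' [a ac _]]; move: ac; rewrite hd inE.
case=> c1 [a ac ->] s1 hd [c2 [a' ac' ->]] s2.
have aa : a = a'.
  by move/card_le1_eqP: (det c.1 [ffun i => (c.2 i).1.2]); apply.
by rewrite -aa in s2; apply: IH s1 hd s2.
Qed.

Definition store0 (w : seq bool) : store := fun r => if r == 0 then w else [::].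

Lemma horner_shift_pow (k x : nat) :
  ((('X + (k%:P)) ^+ k : {poly nat}).[x])%R = (x + k) ^ k.
Proof.
rewrite horner_exp hornerD hornerX hornerC.
by elim: {-2 4}k => // j IH; rewrite GRing.exprS IH expnS.
Qed.

Theorem program_poly_computable (c : com) (f : seq bool -> seq bool) (k : nat) :
  (forall w, exists s n, [/\ exec c (store0 w) s n, s 0 = f w & n <= (size w + k) ^ k]) ->
  poly_computable f.
Proof.
move=> H; pose M := machine (maxreg c) (compile 0 c).
have det : deterministic M by exact: machine_deterministic.
have run w : exists n e, [/\ steps n (init M w) e, halted e, output (e.2 ord0) = f w &
     n <= (size w + k) ^ k].
  have [s [n [ex sf nk]]] := H w.
  pose x : {ffun 'I_(maxreg c).+1 -> tape void} :=
    [ffun i => input_tape void (if i == ord0 then w else [::])].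
  have xs : reps x (store0 w).
    move=> i; rewrite ffunE /store0 -[nat_of_ord i == 0]/(i == ord0).
    set u := if _ then _ else _; split=> j; first by rewrite nth_nil.
    have -> : [seq Some (inl b) | b <- u] = map sym_of u by [].
    by case: (map _ u) => [|a r] //=; case: j => //= j; rewrite nth_nil.
  have [||x' xs' st] := @simulation (maxreg c) (compile 0 c) c _ _ _ ex [::] [::] x _ _ xs => //.
    by rewrite cats0.
  exists n, (cfg (compile 0 c) (0 + csize c) x'); split=> //.
  - move: st; congr (steps _ _ _); rewrite /cfg /init /=; congr (_, _).
    by apply: val_inj; rewrite /= inordK.
  - rewrite /halted /options /= /vtrans inordK; last by rewrite size_comp ltnSn.
    by rewrite size_comp ltnn.
  - by rewrite -sf; apply: rep_output; exact: (xs' ord0).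
exists M; split=> //.
  exists (('X + (k%:P)) ^+ k)%R => w n e st; rewrite horner_shift_pow.
  have [n' [e' [st' h' _ le]]] := run w.
  exact: leq_trans (steps_halted det st' h' st) le.
by move=> w; have [n [e [? ? ? _]]] := run w; exists n, e.
Qed.

(** * Program macros and loops *)

(** Shift and exponent are one parameter, and positive parameters can be increased, so finitely many
    bounds share a single k. *)
Definition polyb (f : nat -> nat) := exists k, forall x, f x <= (x + k) ^ k.

Lemma pow_shift_le x k l : 0 < k -> k <= l -> (x + k) ^ k <= (x + l) ^ l.
Proof.
move=> k0 kl; apply: (@leq_trans ((x + l) ^ k)); first by rewrite leq_exp2r // leq_add2l.
by rewrite leq_pexp2l //; lia.
Qed.

Lemma polyb_max f : polyb f -> exists k, forall l x, k <= l -> f x <= (x + l) ^ l.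
Proof.
case=> k fk; exists k.+1 => l x kl; apply: leq_trans (fk x) _.
case: k kl {fk} => [|k] kl; first by rewrite expn0 expn_gt0; lia.
by apply: pow_shift_le; lia.
Qed.

Lemma polyb_le f g : (forall x, f x <= g x) -> polyb g -> polyb f.
Proof. by move=> fg [k gk]; exists k => x; apply: leq_trans (fg x) (gk x). Qed.

Lemma polyb_const n : polyb (fun=> n).
Proof.
exists n.+1 => x; apply: (@leq_trans (x + n.+1)); first lia.
by rewrite -{1}[x + _]expn1 leq_pexp2l //; lia.
Qed.

Lemma polyb_id : polyb id.
Proof. by exists 1 => x; rewrite expn1; lia. Qed.

Lemma polyb_add f g : polyb f -> polyb g -> polyb (fun x => f x + g x).
Proof.
move=> /polyb_max[k fk] /polyb_max[l gl]; pose m := maxn k l.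
exists m.+2 => x; have h1 := fk m x (leq_maxl _ _); have h2 := gl m x (leq_maxr _ _).
apply: (@leq_trans ((x + m) ^ m * 2)); first by lia.
rewrite expnSr; apply: leq_mul; last by lia.
rewrite expnSr; apply: (@leq_trans ((x + m.+2) ^ m * 1)); last by apply: leq_mul; lia.
by rewrite muln1; case: (m) => // m'; rewrite leq_exp2r //; lia.
Qed.

Lemma polyb_mul f g : polyb f -> polyb g -> polyb (fun x => f x * g x).
Proof.
move=> /polyb_max[k fk] /polyb_max[l gl]; pose m := (maxn k l).+1.
exists (m + m) => x; have h1 := fk m x (leq_trans (leq_maxl _ _) (leqnSn _)).
have h2 := gl m x (leq_trans (leq_maxr _ _) (leqnSn _)).
apply: leq_trans (leq_mul h1 h2) _; rewrite expnD; apply: leq_mul; rewrite leq_exp2r //; lia.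
Qed.

Lemma polyb_exp f n : polyb f -> polyb (fun x => f x ^ n).
Proof.
move=> pf; elim: n => [|n IH]; first exact: polyb_const.
by apply: (@polyb_le _ (fun x => f x * f x ^ n)) => [x|]; [rewrite expnS | apply: polyb_mul].
Qed.

Lemma polyb_comp f g : polyb f -> polyb g -> polyb (fun x => f (g x)).
Proof.
move=> [k fk] pg; apply: (@polyb_le _ (fun x => (g x + k) ^ k)) => [x|]; first exact: fk.
exact/polyb_exp/polyb_add/polyb_const.
Qed.

Ltac polyb_tac := repeat first [assumption | exact: polyb_id | exact: polyb_const
  | apply: polyb_add | apply: polyb_mul | apply: polyb_exp].

Definition runs c s s' n := exists2 n', n' <= n & exec c s s' n'.

Lemma runs_le c s s' n n' : runs c s s' n -> n <= n' -> runs c s s' n'.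
Proof. by case=> k kn e nn; exists k => //; apply: leq_trans nn. Qed.

Lemma runs_skip s n : runs Skip s s n.
Proof. by exists 0 => //; constructor. Qed.

Lemma runs_push s r b : runs (Push r b) s (upd s r (b :: s r)) 2.
Proof. by exists 2 => //; constructor. Qed.

Lemma runs_pop s r : runs (Pop r) s (upd s r (behead (s r))) 1.
Proof. by exists 1 => //; constructor. Qed.

Lemma runs_seq c d s s' s'' n n' : runs c s s' n -> runs d s' s'' n' ->
  runs (Seq c d) s s'' (n + n').
Proof.
case=> k kn e [k' kn' e']; exists (k + k'); first exact: leq_add.
exact: ESeq e e'.
Qed.

Lemma runs_if r (p : option bool -> bool) c d s s' n :
  (if p (ohead (s r)) then runs c s s' n else runs d s s' n) ->
  runs (If r p c d) s s' n.+2.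
Proof.
case: ifP => pr [k kn e]; last by exists k.+1; [lia | apply: EIfF => //; rewrite pr].
by exists (k + 1).+1; [lia | apply: EIfT].
Qed.

Lemma runs_while (sg : nat -> store) r (p : option bool -> bool) c N n :
  (forall i, i < N -> p (ohead (sg i r)) /\ runs c (sg i) (sg i.+1) n) ->
  ~~ p (ohead (sg N r)) -> runs (While r p c) (sg 0) (sg N) (N * n.+2).+1.
Proof.
elim: N sg => [|N IH] sg H pN; first by exists 1 => //; apply: EWhileF.
have [p0 [k kn e]] := H 0 (ltn0Sn _).
have [|k' k'n e'] := IH (fun i => sg i.+1) _ pN; first by move=> i iN; apply: H.
exists (k + k'.+1).+1; first by lia.
exact: EWhileT p0 e e'.
Qed.

Lemma runs_ext c s s' s'' n : s' =1 s'' -> runs c s s' n -> runs c s s'' n.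
Proof. by move=> /funext ->. Qed.

Definition nonempty (x : option bool) := isSome x.
Definition istrue (x : option bool) := x == Some true.

Definition Each a (c : bool -> com) :=
  While a nonempty (If a istrue (Seq (Pop a) (c true)) (Seq (Pop a) (c false))).

Definition Pushes (ds : seq nat) (g : nat -> bool -> bool) (b : bool) : com :=
  foldr (fun r c => Seq (Push r (g r b)) c) Skip ds.

Lemma runs_pushes ds g b s : uniq ds ->
  runs (Pushes ds g b) s (fun r => if r \in ds then g r b :: s r else s r) (2 * size ds).
Proof.
elim: ds s => [|d ds IH] s /=; first by move=> _; apply: runs_skip.
case/andP=> dn /IH H; rewrite mulnS; apply: runs_seq (runs_push _ _ _) _.
apply: runs_ext (H _) => r; rewrite inE /upd; case: eqP => [->|//].
by rewrite (negPf dn).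
Qed.

Lemma runs_transfer a ds g s : a \notin ds -> uniq ds ->
  runs (Each a (Pushes ds g)) s
    (fun r => if r == a then [::] else if r \in ds then rev [seq g r b | b <- s a] ++ s r else s r)
    (size (s a) * (2 * size ds + 5)).+1.
Proof.
move=> an un.
pose sg i : store := fun r => if r == a then drop i (s a) else
  if r \in ds then rev [seq g r b | b <- take i (s a)] ++ s r else s r.
have s0 : sg 0 = s.
  by apply/funext => r; rewrite /sg drop0 take0; case: eqP => [->|] //=; case: ifP.
have sN : sg (size (s a)) = (fun r => if r == a then [::] else if r \in ds then rev [seq g r b | b <- s a] ++ s r else s r).
  by apply/funext => r; rewrite /sg drop_size take_size.
rewrite -sN -{1}s0; apply: (runs_le (n := (size (s a) * (2 * size ds + 3).+2).+1)); last by lia.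
apply: runs_while; last by rewrite /sg eqxx drop_size.
move=> i iN; rewrite {1}/sg eqxx (drop_nth false iN); split=> //.
have -> : 2 * size ds + 3 = (1 + 2 * size ds).+2 by lia.
set b := nth false (s a) i.
have key : runs (Seq (Pop a) (Pushes ds g b)) (sg i) (sg i.+1) (1 + 2 * size ds).
  apply: runs_seq (runs_pop _ _) _; apply: runs_ext (runs_pushes g b _ un) => r.
  rewrite /upd /sg; case: eqP => [->|ra].
    by rewrite (negPf an) eqxx (drop_nth false iN).
  by case: (r \in ds) => //; rewrite (take_nth false iN) map_rcons rev_rcons.
apply: runs_if; rewrite {1}/sg eqxx (drop_nth false iN) /= -/b /istrue.
by case: (b) key.
Qed.

Definition keep (r : nat) (b : bool) := b.
Definition Move a b := Each a (Pushes [:: b] keep).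
(** Each transfer between stacks reverses; the detour over [t] restores the order. *)
Definition Copy a b t := Seq (Move a t) (Each t (Pushes [:: a; b] keep)).

Lemma runs_move a b s : a != b ->
  runs (Move a b) s (upd (upd s b (rev (s a) ++ s b)) a [::]) (size (s a) * 7).+1.
Proof.
move=> ab; apply: runs_ext (runs_transfer keep s _ _) => //; last by rewrite inE.
move=> r; rewrite /upd inE /keep map_id; case: eqP => // _.
by case: eqP => // ->.
Qed.

Lemma runs_copy a b t s : a != b -> a != t -> b != t -> s t = [::] ->
  runs (Copy a b t) s (upd s b (s a ++ s b)) (size (s a) * 16).+2.
Proof.
move=> ab at_ bt st.
apply: (runs_le (n := (size (s a) * 7).+1 + (size (s a) * 9).+1)); last by lia.
apply: runs_seq (runs_move _ at_) _.
set s1 := upd _ _ _; have s1t : s1 t = rev (s a).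
  by rewrite /s1 /upd eq_sym (negPf at_) eqxx st cats0.
have -> : size (s a) = size (s1 t) by rewrite s1t size_rev.
apply: runs_ext (runs_transfer keep s1 (ds := [:: a; b]) _ _) => //.
- move=> r; rewrite !inE /keep map_id s1t revK /s1 /upd; case: eqP => [->|nt].
    by rewrite eq_sym (negPf bt) st.
  have [->|nb] := eqVneq r b; first by rewrite orbT eq_sym (negPf ab) //.
  rewrite orbF; have [->|//] := eqVneq r a; by rewrite cats0.
- by rewrite !inE negb_or ![t == _]eq_sym at_ bt.
- by rewrite /= inE ab.
Qed.

Fixpoint Pushn n r := if n is n'.+1 then Seq (Push r true) (Pushn n' r) else Skip.

Lemma runs_pushn n r s : runs (Pushn n r) s (upd s r (nseq n true ++ s r)) (2 * n).
Proof.
elim: n s => [|n IH] s /=.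
  by apply: runs_ext (runs_skip _ _) => x; rewrite /upd; case: eqP => [->|].
rewrite mulnS; apply: runs_seq (runs_push _ _ _) _; apply: runs_ext (IH _) => x.
rewrite /upd eqxx; case: eqP => // _; by rewrite -[true :: s r]cat1s catA -[nseq n true ++ _]/(nseq n true ++ nseq 1 true) -nseqD addn1.
Qed.

Definition Clear a := While a nonempty (Pop a).

Lemma runs_clear a s : runs (Clear a) s (upd s a [::]) (size (s a) * 3).+1.
Proof.
pose sg i : store := upd s a (drop i (s a)).
have s0 : sg 0 = s by apply/funext => r; rewrite /sg /upd drop0; case: eqP => [->|].
have sN : sg (size (s a)) = upd s a [::] by rewrite /sg drop_size.
rewrite -sN -{1}s0.
apply: runs_while; last by rewrite /sg /upd eqxx drop_size.
move=> i iN; split; first by rewrite /sg /upd eqxx (drop_nth false iN).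
apply: runs_ext (runs_pop _ _) => r; rewrite /sg /upd eqxx; case: eqP => // _.
by rewrite (drop_nth false iN).
Qed.

(** On unary numbers this is truncated subtraction, on a bit array it brings the bit with index
    [size (s a)] to the top. One routine thus serves both comparisons and lookups. *)
Definition Drop a b := While a nonempty (Seq (Pop a) (Pop b)).

Lemma runs_drop a b s : a != b ->
  runs (Drop a b) s (upd (upd s b (drop (size (s a)) (s b))) a [::]) (size (s a) * 4).+1.
Proof.
move=> ab; pose sg i : store := upd (upd s b (drop i (s b))) a (drop i (s a)).
have s0 : sg 0 = s.
  apply/funext => r; rewrite /sg /upd !drop0.
  by case: eqP => [->|_] //; case: eqP => [->|].
have sN : sg (size (s a)) = upd (upd s b (drop (size (s a)) (s b))) a [::] by rewrite /sg drop_size.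
rewrite -sN -{1}s0.
apply: runs_while; last by rewrite /sg /upd eqxx drop_size.
move=> i iN; split; first by rewrite /sg /upd eqxx (drop_nth false iN).
apply: runs_ext (runs_seq (runs_pop _ _) (runs_pop _ _)) => r; rewrite /sg /upd !eqxx.
rewrite [b == a]eq_sym (negPf ab); case: eqP => [->|_].
  by rewrite [b == a]eq_sym (negPf ab) -drop1 drop_drop.
by case: eqP => // _; rewrite -drop1 drop_drop.
Qed.

(* Registers 1-3 are scratch, 4 holds truth values, 5 a unary counter; the
   data registers start at 6, and the first of them is a bit array. *)
Definition data_reg i := i.+4.+2.

Definition clean (s : store) := [/\ s 1 = [::], s 2 = [::], s 3 = [::] & s 4 = [::]].
Definition bounded (b R : nat) (s : store) := forall i, data_reg i != R -> size (s (data_reg i)) <= b.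

Definition Atom c i d j p :=
  Seq (Copy i 1 3) (Seq (Pushn c 1) (Seq (Copy j 2 3) (Seq (Pushn d 2) (Seq (Drop 1 2)
    (Seq (If 2 p (Push 4 true) (Push 4 false)) (Clear 2)))))).

Ltac upd_tac := let r := fresh "r" in move=> r; rewrite /upd /=;
  repeat (case: eqP => [?|?]; try subst r; rewrite //=).

Lemma runs_atom c i d j p b s : s 1 = [::] -> s 2 = [::] -> s 3 = [::] ->
  size (s (data_reg i)) <= b -> size (s (data_reg j)) <= b ->
  runs (Atom c (data_reg i) d (data_reg j) p) s
    (upd s 4 (p (ohead (drop (c + size (s (data_reg i))) (nseq d true ++ s (data_reg j)))) :: s 4))
    (50 * (b + c + d) + 50).
Proof.
move=> s1 s2 s3 ib jb; set x := drop _ _.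
have xs : size x <= b + d by rewrite size_drop size_cat size_nseq; lia.
pose a1 := upd s 1 (s (data_reg i)); pose a2 := upd s 1 (nseq c true ++ s (data_reg i)).
pose a3 := upd a2 2 (s (data_reg j)); pose a4 := upd a2 2 (nseq d true ++ s (data_reg j)).
pose a5 := upd s 2 x; pose a6 := upd a5 4 (p (ohead x) :: s 4).
have r1 : runs (Copy (data_reg i) 1 3) s a1 (b * 16).+2.
  apply: runs_le (runs_ext _ (runs_copy _ _ _ s3)) _ => //; last by lia.
  by rewrite /a1; upd_tac; rewrite s1 cats0.
have r2 : runs (Pushn c 1) a1 a2 (2 * c).
  by apply: runs_ext (runs_pushn _ _ _); rewrite /a1 /a2; upd_tac.
have r3 : runs (Copy (data_reg j) 2 3) a2 a3 (b * 16).+2.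
  have a23 : a2 3 = [::] by [].
  apply: runs_le (runs_ext _ (runs_copy _ _ _ a23)) _ => //; last by rewrite /a2 /upd /=; lia.
  by rewrite /a3 /a2; upd_tac; rewrite s2 cats0.
have r4 : runs (Pushn d 2) a3 a4 (2 * d).
  by apply: runs_ext (runs_pushn _ _ _); rewrite /a3 /a4; upd_tac.
have r5 : runs (Drop 1 2) a4 a5 ((b + c) * 4).+1.
  apply: runs_le (runs_ext _ (runs_drop _ _)) _ => //; last first.
    by rewrite /a4 /a2 /upd /= size_cat size_nseq; lia.
  rewrite /a5 /a4 /a2; by upd_tac; rewrite ?s1 ?s2 ?size_cat ?size_nseq.
have r6 : runs (If 2 p (Push 4 true) (Push 4 false)) a5 a6 4.
  apply: runs_if; rewrite -[a5 2]/x /a6.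
  by case: (p (ohead x)); apply: runs_ext (runs_push _ _ _); rewrite /a5; upd_tac.
have r7 : runs (Clear 2) a6 (upd s 4 (p (ohead x) :: s 4)) ((b + d) * 3).+1.
  apply: runs_le (runs_ext _ (runs_clear _ _)) _; last by rewrite /a6 /a5 /upd /=; lia.
  by rewrite /a6 /a5; upd_tac; rewrite ?s2.
apply: runs_le (runs_seq r1 (runs_seq r2 (runs_seq r3 (runs_seq r4 (runs_seq r5 (runs_seq r6 r7)))))) _.
lia.
Qed.

(** The constant offsets in [BLt] give non-strict comparison and successor and, with a variable that
    is always zero, comparison with constants. *)
Inductive bexp :=
| BLt (c i d j : nat)
| BBit (i : nat)
| BTrue
| BNot (e : bexp)
| BAnd (e e' : bexp).

Fixpoint beval (e : bexp) (val : nat -> nat) (inp : seq bool) : bool :=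
  match e with
  | BLt c i d j => c + val i < d + val j
  | BBit i => nth false inp (val i)
  | BTrue => true
  | BNot e => ~~ beval e val inp
  | BAnd e e' => beval e val inp && beval e' val inp
  end.

Fixpoint bcom (e : bexp) : com :=
  match e with
  | BLt c i d j => Atom c (data_reg i) d (data_reg j) nonempty
  | BBit i => Atom 0 (data_reg i) 0 (data_reg 0) istrue
  | BTrue => Push 4 true
  | BNot e => Seq (bcom e) (If 4 istrue (Seq (Pop 4) (Push 4 false)) (Seq (Pop 4) (Push 4 true)))
  | BAnd e e' => Seq (bcom e) (If 4 istrue (Seq (Pop 4) (bcom e')) Skip)
  end.

Definition sval (s : store) i := size (s (data_reg i)).
Definition store_eval e (s : store) := beval e (sval s) (s (data_reg 0)).

Lemma runs_bcom e : exists2 tau, polyb tau & forall s b, s 1 = [::] -> s 2 = [::] -> s 3 = [::] ->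
  (forall i, size (s (data_reg i)) <= b) -> runs (bcom e) s (upd s 4 (store_eval e s :: s 4)) (tau b).
Proof.
elim: e => [c i d j|i||e [t pt H]|e [t pt H] e' [t' pt' H']] /=.
- exists (fun b => 50 * (b + c + d) + 50); first by polyb_tac.
  move=> s b s1 s2 s3 sb; have := runs_atom c d nonempty s1 s2 s3 (sb i) (sb j).
  congr (runs _ _ (upd _ _ (_ :: _)) _); rewrite /store_eval /= /sval.
  set n := c + _; set l := _ ++ _.
  have -> : d + size (s (data_reg j)) = size l by rewrite size_cat size_nseq.
  rewrite -subn_gt0 -size_drop; by case: (drop n l).
- exists (fun b => 50 * (b + 0 + 0) + 50); first by polyb_tac.
  move=> s b s1 s2 s3 sb; have := runs_atom 0 0 istrue s1 s2 s3 (sb i) (sb 0).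
  congr (runs _ _ (upd _ _ (_ :: _)) _); rewrite /store_eval /= /sval add0n.
  move: (size (s (data_reg i))) (s (data_reg 0)) => n l; have [lt|ge] := ltnP n (size l).
    by rewrite (drop_nth false lt) /istrue /=; case: nth.
  by rewrite drop_oversize // nth_default.
- by exists (fun=> 2); [polyb_tac | move=> s b *; apply: runs_push].
- exists (fun b => t b + 5); first by polyb_tac.
  move=> s b s1 s2 s3 sb; apply: runs_seq (H s b s1 s2 s3 sb) _.
  apply: runs_if; rewrite {1}/upd /= /istrue /store_eval /=.
  by case: (beval e _ _) => /=; apply: runs_ext (runs_seq (runs_pop _ _) (runs_push _ _ _)); upd_tac.
- exists (fun b => t b + (1 + t' b + 2)); first by polyb_tac.
  move=> s b s1 s2 s3 sb; apply: runs_seq (H s b s1 s2 s3 sb) _; rewrite addn2.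
  apply: runs_if; rewrite {1}/upd /= /istrue /store_eval /=; case: (beval e _ _) => /=; last first.
    by apply: runs_ext (runs_skip _ _); upd_tac.
  have r1 : runs (Pop 4) (upd s 4 (true :: s 4)) s 1.
    by apply: runs_ext (runs_pop _ _); upd_tac.
  by apply: runs_seq r1 _; apply: H'.
Qed.

Definition Cond e c d := Seq (bcom e) (If 4 istrue (Seq (Pop 4) c) (Seq (Pop 4) d)).

(** The contract of printing code: it prepends [g s] to [R] and restores everything else. [R] is
    exempt from the size bound, and [g] must ignore it, since the output keeps growing from one
    iteration to the next. *)
Definition emits bnd R (vs : seq nat) c (g : store -> seq bool) :=
  (forall s x, g (upd s R x) = g s) /\
  exists2 tau, polyb tau & forall s b, clean s -> {in vs, forall v, s v = [::]} ->
    bounded b R s -> s bnd = nseq (size (s bnd)) true ->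
    runs c s (upd s R (g s ++ s R)) (tau b).

Lemma emits_push bnd R b : emits bnd R [::] (Push R b) (fun=> [:: b]).
Proof.
split=> //; exists (fun=> 2); first by polyb_tac.
by move=> s n _ _ _ _; apply: runs_push.
Qed.

Lemma bev_upd e s R x : R < 6 -> store_eval e (upd s R x) = store_eval e s.
Proof.
move=> R6; have sE i : upd s R x (data_reg i) = s (data_reg i).
  rewrite /upd; case: eqP => // iR; by move: R6; rewrite -iR.
rewrite /store_eval sE; congr (beval e _ _); apply/funext => i; by rewrite /sval sE.
Qed.

Lemma emits_bev bnd R e : R < 6 ->
  emits bnd R [::] (Cond e (Push R true) (Push R false)) (fun s => [:: store_eval e s]).
Proof.
move=> R6; split=> [s x|]; first by rewrite bev_upd.
have [t pt H] := runs_bcom e.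
exists (fun b => t b + (1 + 2 + 2)); first by polyb_tac.
move=> s b [s1 s2 s3 s4] _ sb _; apply: runs_seq (H s b s1 s2 s3 _) _.
  by move=> i; apply: sb; apply/eqP => e'; move: R6; rewrite -e'.
rewrite addn2; apply: runs_if; rewrite {1}/upd /= /istrue.
have r1 x : runs (Pop 4) (upd s 4 (x :: s 4)) s 1.
  by apply: runs_ext (runs_pop _ _); upd_tac.
by case: (store_eval e s); apply: runs_seq (r1 _) (runs_push _ _ _).
Qed.

Lemma emits_filter bnd R e : R < 6 ->
  emits bnd R [::] (Cond e (Push R true) Skip) (fun s => nseq (store_eval e s) true).
Proof.
move=> R6; split=> [s x|]; first by rewrite bev_upd.
have [t pt H] := runs_bcom e.
exists (fun b => t b + (1 + 2 + 2)); first by polyb_tac.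
move=> s b [s1 s2 s3 s4] _ sb _; apply: runs_seq (H s b s1 s2 s3 _) _.
  by move=> i; apply: sb; apply/eqP => e'; move: R6; rewrite -e'.
rewrite addn2; apply: runs_if; rewrite {1}/upd /= /istrue.
have r1 x : runs (Pop 4) (upd s 4 (x :: s 4)) s 1.
  by apply: runs_ext (runs_pop _ _); upd_tac.
case: (store_eval e s); apply: runs_seq (r1 _) _; first exact: runs_push.
by apply: runs_ext (runs_skip _ _) => r; rewrite /upd; case: eqP => [->|].
Qed.

Definition For bnd v c := Seq (Copy bnd v 3) (While v nonempty (Seq (Pop v) c)).

(** The counter runs downwards while output is prepended, so the printed blocks appear in increasing
    order of the counter. *)
Lemma emits_for bnd R vs c g v : 5 < bnd -> bnd != R -> 5 < v -> v != R -> v != bnd ->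
  v \notin vs -> R \notin vs -> (forall r, 0 < r < 5 -> r != R) -> emits bnd R vs c g ->
  emits bnd R (v :: vs) (For bnd v c)
    (fun s => flatten [seq g (upd s v (nseq x true)) | x <- iota 0 (size (s bnd))]).
Proof.
move=> b5 bR v5 vR vb vvs Rvs R15 [gR [t pt H]]; split.
  move=> s x; have -> : upd s R x bnd = s bnd by rewrite /upd (negPf bR).
  congr flatten; apply: eq_map => k.
  rewrite -(gR (upd s v (nseq k true)) x); congr g; apply/funext => r; rewrite /upd.
  by case: eqP => // ->; rewrite (negPf vR).
exists (fun b => (b * 16).+2 + (b * (1 + t b).+2).+1).
  by apply: (@polyb_le _ (fun b => b * 16 + 2 + (b * (1 + t b + 2) + 1)));
    [move=> x; lia | polyb_tac].
move=> s b cs svs sb sbnd; set N := size (s bnd).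
have [s1 s2 s3 s4] := cs.
have sv : s v = [::] by apply: svs; rewrite inE eqxx.
have Nb : N <= b.
  by have := sb (bnd - 6); rewrite /data_reg (_ : (bnd - 6).+4.+2 = bnd) //; [apply | lia].
pose G k := flatten [seq g (upd s v (nseq x true)) | x <- iota (N - k) k].
pose sg k : store := upd (upd s v (nseq (N - k) true)) R (G k ++ s R).
have r1 : runs (Copy bnd v 3) s (sg 0) (b * 16).+2.
  apply: runs_le (runs_ext _ (runs_copy _ _ _ s3)) _.
  - move=> r; rewrite /sg /G /= /upd subn0 sv cats0 -sbnd.
    case: (r =P v) => [->|_]; first by rewrite (negPf vR).
    by case: eqP => // ->.
  - by rewrite eq_sym.
  - by apply/eqP; lia.
  - by apply/eqP; lia.
  - by rewrite -/N; lia.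
have r2 : runs (While v nonempty (Seq (Pop v) c)) (sg 0) (sg N) (b * (1 + t b).+2).+1.
  apply: (runs_le (n := (N * (1 + t b).+2).+1)); last by rewrite ltnS leq_mul2r Nb orbT.
  apply: runs_while; last by rewrite /sg /upd (negPf vR) eqxx subnn.
  move=> k kN; have Nk : N - k = (N - k.+1).+1 by lia.
  split; first by rewrite /sg /upd (negPf vR) eqxx Nk.
  apply: runs_seq (runs_pop _ _) _.
  set s' := upd (sg k) v _.
  have s'E : s' = upd (upd s v (nseq (N - k.+1) true)) R (G k ++ s R).
    apply/funext => r; rewrite /s' /sg /upd (negPf vR) eqxx Nk /=.
    by case: eqP => [->|//]; rewrite (negPf vR).
  have s'e r : r != v -> r != R -> s' r = s r.
    by move=> rv rR; rewrite s'E /upd (negPf rR) (negPf rv).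
  have gE : g s' = g (upd s v (nseq (N - k.+1) true)) by rewrite s'E gR.
  apply: runs_ext (H s' b _ _ _ _).
  - move=> r; rewrite gE s'E /sg /upd eqxx; case: eqP => // _.
    rewrite catA; congr (_ ++ _); rewrite /G.
    have -> : N - k = (N - k.+1).+1 by lia.
    by [].
  - split; rewrite s'e ?R15 //; apply/eqP; lia.
  - move=> u uvs; have uv : u != v by apply: contraNneq vvs => <-.
    have uR : u != R by apply: contraNneq Rvs => <-.
    by rewrite s'e // svs // inE uvs orbT.
  - move=> i iR; have [->|iv] := eqVneq (data_reg i) v.
      by rewrite s'E /upd (negPf vR) eqxx size_nseq; lia.
    by rewrite s'e // sb.
  - by rewrite s'e // eq_sym.
apply: runs_ext (runs_seq r1 r2) => r; rewrite /sg /upd.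
case: eqP => [_|_]; first by rewrite /G subnn.
by case: eqP => [->|//]; rewrite subnn sv.
Qed.

Definition Fors bnd vs c := foldr (For bnd) c vs.

Fixpoint loop_out bnd vs (g : store -> seq bool) (s : store) : seq bool :=
  if vs is v :: vs' then
    flatten [seq loop_out bnd vs' g (upd s v (nseq x true)) | x <- iota 0 (size (s bnd))]
  else g s.

Lemma emits_fors bnd R vs ws c g : 5 < bnd -> bnd != R -> (forall r, 0 < r < 5 -> r != R) ->
  uniq (vs ++ ws) -> all (fun v => 5 < v) vs -> bnd \notin vs -> R \notin vs ++ ws ->
  emits bnd R ws c g -> emits bnd R (vs ++ ws) (Fors bnd vs c) (loop_out bnd vs g).
Proof.
move=> b5 bR R15 + + + + em; elim: vs => //= v vs IH /andP[vn un] /andP[v5 a5].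
rewrite !inE !negb_or => /andP[bv bn] /andP[Rv Rn].
apply: emits_for => //; try by rewrite eq_sym.
exact: IH.
Qed.

(** Most significant digit first, as for the outermost loop. *)
Definition digit b D i k := (i %/ b ^ (D - k.+1)) %% b.

Fixpoint assign b vs (s : store) i : store :=
  if vs is v :: vs' then
    assign b vs' (upd s v (nseq (i %/ b ^ size vs') true)) (i %% b ^ size vs')
  else s.

Lemma flatten_iota (T : Type) (F : nat -> nat -> seq T) n b :
  flatten [seq flatten [seq F x y | y <- iota 0 n] | x <- iota 0 b] =
  flatten [seq F (i %/ n) (i %% n) | i <- iota 0 (b * n)].
Proof.
elim: b => [|b IH]; first by rewrite mul0n.
rewrite -addn1 iotaD map_cat flatten_cat IH addn1 mulSnr iotaD map_cat flatten_cat add0n.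
congr (_ ++ _); rewrite /= cats0 add0n -[b * n]addn0 iotaDl -map_comp; congr flatten.
apply/eq_in_map => y; rewrite mem_iota /= add0n => yn /=.
by rewrite divnMDl ?(leq_ltn_trans _ yn) // modnMDl divn_small ?modn_small // addn0.
Qed.

(** Nested loops amount to one loop over an index whose base-b digits are the counters; in this form
    the output is compared with the row-major adjacency matrix. *)
Lemma gs_asg bnd vs g s b : bnd \notin vs -> size (s bnd) = b ->
  loop_out bnd vs g s = flatten [seq g (assign b vs s i) | i <- iota 0 (b ^ size vs)].
Proof.
elim: vs s => [|v vs IH] s /=; first by rewrite /= cats0.
rewrite inE negb_or => /andP[bv bn] sb; rewrite sb expnS -(flatten_iota (fun x y => g (assign b vs (upd s v (nseq x true)) y))).
congr flatten; apply: eq_map => x; apply: IH => //.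
by rewrite /upd (negPf bv).
Qed.

Lemma dig_mod b n i k : k < n -> digit b n (i %% b ^ n) k = digit b n.+1 i k.+1.
Proof.
move=> kn; rewrite /digit subSS; set m := n - k.+1.
have -> : n = k.+1 + m by lia.
by rewrite expnD -modn_divl modn_dvdm // expnS dvdn_mulr.
Qed.

Lemma asgE b vs s i r : uniq vs -> i < b ^ size vs ->
  assign b vs s i r = if r \in vs then nseq (digit b (size vs) i (index r vs)) true else s r.
Proof.
elim: vs s i => //= v vs IH s i /andP[vn un] ib.
have b0 : 0 < b ^ size vs by move: ib; rewrite expnS; case: (b ^ _); rewrite ?muln0.
rewrite IH ?ltn_mod // inE /upd; case rv: (r \in vs); last first.
  rewrite orbF; case: eqP => [->|//]; rewrite eqxx /digit subSS subn0 modn_small //.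
  by rewrite ltn_divLR // -expnS.
have vr : (v == r) = false by apply/negP => /eqP vr; move: vn; rewrite vr rv.
by rewrite orbT vr dig_mod // index_mem.
Qed.

(** * Binary counters *)

Fixpoint binc (l : seq bool) : seq bool :=
  if l is b :: l' then if b then false :: binc l' else true :: l' else [:: true].

Definition bins m := iter m binc [::].

Lemma binc_split l : exists a l', [/\ l = nseq a true ++ l', ~~ istrue (ohead l') &
  binc l = nseq a false ++ true :: behead l'].
Proof.
elim: l => [|[] l [a [l' [e h b]]]] /=; first by exists 0, [::].
  by exists a.+1, l'; rewrite /= -e -b.
by exists 0, (false :: l).
Qed.

Lemma size_bins m : size (bins m) <= m.
Proof.
elim: m => // m; rewrite /bins /=; move: (iter _ _ _) => l lm.
apply: (@leq_trans (size l).+1) => //.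
by elim: l {lm} => //= [[] l IH] //=.
Qed.

Definition Inc := Seq (While 0 istrue (Seq (Pop 0) (Push 1 true)))
  (Seq (If 0 nonempty (Pop 0) Skip) (Seq (Push 0 true) (While 1 nonempty (Seq (Pop 1) (Push 0 false))))).

Lemma runs_inc s : s 1 = [::] -> runs Inc s (upd s 0 (binc (s 0))) (size (s 0) * 10 + 10).
Proof.
move=> s1; have [a [l' [e h ->]]] := binc_split (s 0).
have al : a <= size (s 0) by rewrite e size_cat size_nseq leq_addr.
pose s' := upd (upd s 0 l') 1 (nseq a true).
have r1 : runs (While 0 istrue (Seq (Pop 0) (Push 1 true))) s s' (a * 5).+1.
  pose sg i := upd (upd s 0 (nseq (a - i) true ++ l')) 1 (nseq i true).
  have s0 : sg 0 = s by apply/funext; rewrite /sg subn0 -e; upd_tac.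
  have sN : sg a = s' by rewrite /sg subnn.
  rewrite -sN -{1}s0; apply: runs_while; last by rewrite /sg /upd /= subnn.
  move=> i ia; have ai : a - i = (a - i.+1).+1 by lia.
  split; first by rewrite /sg /upd /= ai.
  apply: runs_ext (runs_seq (runs_pop _ _) (runs_push _ _ _)).
  by rewrite /sg ai; upd_tac.
pose s2 := upd s' 0 (behead l').
have r2 : runs (If 0 nonempty (Pop 0) Skip) s' s2 3.
  apply: runs_if; rewrite /s' /upd /= -/s'; case: ifP => [_|].
    by apply: runs_ext (runs_pop _ _); rewrite /s2 /s'; upd_tac.
  move=> l0; apply: runs_ext (runs_skip _ _); rewrite /s2 /s'; upd_tac.
  by case: (l') l0.
pose s3 := upd s2 0 (true :: behead l').
have r3 : runs (Push 0 true) s2 s3 2.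
  by apply: runs_ext (runs_push _ _ _); rewrite /s3 /s2; upd_tac.
have r4 : runs (While 1 nonempty (Seq (Pop 1) (Push 0 false))) s3
    (upd s 0 (nseq a false ++ true :: behead l')) (a * 5).+1.
  pose sg i := upd (upd s 0 (nseq i false ++ true :: behead l')) 1 (nseq (a - i) true).
  have s0 : sg 0 = s3 by apply/funext; rewrite /sg subn0 /s3 /s2 /s'; upd_tac.
  have sN : sg a = upd s 0 (nseq a false ++ true :: behead l').
    by apply/funext; rewrite /sg subnn; upd_tac.
  rewrite -sN -s0; apply: runs_while; last by rewrite /sg /upd /= subnn.
  move=> i ia; have ai : a - i = (a - i.+1).+1 by lia.
  split; first by rewrite /sg /upd /= ai.
  apply: runs_ext (runs_seq (runs_pop _ _) (runs_push _ _ _)).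
  by rewrite /sg ai; upd_tac.
by apply: runs_le (runs_seq r1 (runs_seq r2 (runs_seq r3 r4))) _; lia.
Qed.

Definition ToBin := While 5 nonempty (Seq (Pop 5) Inc).

Lemma runs_tobin s m : s 0 = [::] -> s 1 = [::] -> s 5 = nseq m true ->
  runs ToBin s (upd (upd s 0 (bins m)) 5 [::]) (m * (m * 10 + 13)).+1.
Proof.
move=> s0 s1 s5; pose sg i := upd (upd s 0 (bins i)) 5 (nseq (m - i) true).
have e0 : sg 0 = s by apply/funext; rewrite /sg subn0; upd_tac.
have eN : sg m = upd (upd s 0 (bins m)) 5 [::] by rewrite /sg subnn.
rewrite -eN -{1}e0; apply: (runs_le (n := (m * (1 + (m * 10 + 10)).+2).+1)); last by lia.
apply: runs_while; last by rewrite /sg /upd /= subnn.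
move=> i im; have mi : m - i = (m - i.+1).+1 by lia.
split; first by rewrite /sg /upd /= mi.
apply: runs_seq (runs_pop _ _) _; set s' := upd (sg i) 5 _.
have s'0 : s' 0 = bins i by [].
have s'1 : s' 1 = [::] by [].
apply: runs_le (runs_ext _ (runs_inc s'1)) _; last first.
  by rewrite s'0; have := size_bins i; lia.
by rewrite s'0 /s' /sg mi; upd_tac.
Qed.

Lemma flatten_sing (T U : Type) (h : T -> U) l : flatten [seq [:: h x] | x <- l] = map h l.
Proof. by elim: l => //= x l ->. Qed.

Lemma flatten_nseq (T : Type) (h : T -> bool) l :
  flatten [seq nseq (h x) true | x <- l] = nseq (count h l) true.
Proof. by elim: l => //= x l ->; rewrite -nseqD. Qed.

Lemma gs_const bnd vs b s : bnd \notin vs ->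
  loop_out bnd vs (fun=> [:: b]) s = nseq (size (s bnd) ^ size vs) b.
Proof.
move=> bn; rewrite (gs_asg _ bn (erefl _)) flatten_sing.
by rewrite -[X in nseq X b](size_iota 0); elim: (iota _ _) => //= x l ->.
Qed.

Definition regs o m v6 v8 v9 v10 v11 : store :=
  nth [::] [:: o; [::]; [::]; [::]; [::]; m; v6; [::]; v8; v9; v10; v11].

(** * The program that prints an instance *)

Section Program.
Variables (c0 d D : nat) (phi psi : bexp).

Definition xs := iota 12 D.
Definition ys := iota (12 + D) D.

(** The test [r != 6] sends the bit itself to register 6 and a constant one to 8 and 11, which
    thereby receive the input length in unary. *)
Definition stage0 := Seq (Move 0 1)
  (Seq (Each 1 (Pushes [:: 6; 8; 11] (fun r b => (r != 6) || b))) (Pushn c0 8)).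
(** Pushing a constant inside d nested loops computes a power in unary. The last loops put the
    padding in front of the input. *)
Definition stage1 := Seq (Fors 8 (iota 12 d) (Push 10 true))
  (Seq (Fors 8 (iota 12 d.+1) (Push 9 true))
  (Seq (Fors 8 (iota 12 d) (Push 11 true)) (Fors 8 (iota 12 d) (Push 6 false)))).
(** The output is a stack and is built from its end: the threshold comes first, then the matrix, the
    separator and the unary number of vertices. *)
Definition stage2 := Seq (Fors 9 xs (Cond psi (Push 5 true) Skip)) ToBin.
Definition stage3 :=
  Seq (Fors 9 xs (Fors 9 ys (Cond phi (Push 0 true) (Push 0 false))))
  (Seq (Push 0 false) (Fors 9 xs (Push 0 true))).
Definition prog := Seq stage0 (Seq stage1 (Seq stage2 stage3)).

Definition base x := x + c0.
Definition orig x := base x ^ d.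
Definition side x := base x ^ d.+1.
Definition verts x := side x ^ D.
(** Variable k is the length of register 6 + k. Variables 3, 4 and 5 will be [B], [P0] and [END];
    the digits of the two vertices follow. *)
Definition env x i j : nat -> nat :=
  nth 0 ([:: orig x + x; 0; base x; side x; orig x; orig x + x] ++
    mkseq (digit (side x) D i) D ++ mkseq (digit (side x) D j) D).
Definition binp w := nseq (orig (size w)) false ++ w.
Definition pcount w := count (fun i => beval psi (env (size w) i 0) (binp w)) (iota 0 (verts (size w))).
Definition pout w :=
  nseq (verts (size w)) true ++ false ::
  [seq beval phi (env (size w) i j) (binp w)
     | i <- iota 0 (verts (size w)), j <- iota 0 (verts (size w))] ++ bins (pcount w).

Definition size_bound x := side x + orig x + x + c0.

Lemma polyb_side : polyb side.
Proof. by apply: polyb_exp; rewrite /base; polyb_tac. Qed.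

Lemma polyb_big : polyb size_bound.
Proof.
rewrite /size_bound; apply: polyb_add; last by polyb_tac.
apply: polyb_add; last by polyb_tac.
by apply: polyb_add; [exact: polyb_side | apply: polyb_exp; rewrite /base; polyb_tac].
Qed.

Ltac mk_tac := let r := fresh "r" in move=> r; rewrite /upd /regs;
  do 12 (case: r => [|r] //=); rewrite ?nth_nil //.

Lemma mk_high o m v6 v8 v9 v10 v11 r : 11 < r -> regs o m v6 v8 v9 v10 v11 r = [::].
Proof. by move=> h; rewrite /regs nth_default. Qed.

Lemma run_stage0 w : runs stage0 (store0 w)
  (regs [::] [::] w (nseq (base (size w)) true) [::] [::] (nseq (size w) true))
  ((size w * 7).+1 + ((size w * 11).+1 + 2 * c0)).
Proof.
have r1 : runs (Move 0 1) (store0 w) (upd (fun=> [::]) 1 (rev w)) (size w * 7).+1.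
  apply: runs_ext (runs_move _ _) => // r; rewrite /upd /store0 /= cats0.
  by case: r => [|[|r]].
have r2 := @runs_transfer 1 [:: 6; 8; 11] (fun r b => (r != 6) || b) (upd (fun=> [::]) 1 (rev w)) isT isT.
have e2 : (upd (fun=> [::]) 1 (rev w)) 1 = rev w by [].
rewrite e2 size_rev /= in r2.
apply: runs_seq r1 _; apply: runs_seq r2 _.
apply: runs_ext (runs_pushn _ _ _).
have tr l : [seq true | b <- l] = nseq (size l) true :> seq bool by elim: l => //= b l ->.
move=> r; rewrite /upd /regs.
have [->/=|n8] := eqVneq r 8; first by rewrite cats0 tr size_rev rev_nseq -nseqD addnC.
have [->/=|n1] := eqVneq r 1; first by [].
rewrite !inE; have [->/=|n6] := eqVneq r 6; first by rewrite map_id revK cats0.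
have [->/=|n11] := eqVneq r 11; first by rewrite cats0 tr size_rev rev_nseq.
move: n1 n6 n11 n8; do 12 (case: r => [|r] //=); by rewrite nth_nil.
Qed.

Lemma mk_bounded o m v6 v8 v9 v10 v11 b R :
  (6 != R -> size v6 <= b) -> (8 != R -> size v8 <= b) -> (9 != R -> size v9 <= b) ->
  (10 != R -> size v10 <= b) -> (11 != R -> size v11 <= b) ->
  bounded b R (regs o m v6 v8 v9 v10 v11).
Proof.
move=> h6 h8 h9 h10 h11 i; rewrite /regs /data_reg.
do 6 (case: i => [|i] //); by rewrite /= nth_nil.
Qed.

Lemma loops_empty n o m v6 v8 v9 v10 v11 k : 11 < k ->
  {in iota k n, forall v, regs o m v6 v8 v9 v10 v11 v = [::]}.
Proof. by move=> h v; rewrite mem_iota => /andP[kv _]; apply: mk_high; apply: leq_trans kv. Qed.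

Lemma iota_notin r k n : r < k -> r \notin iota k n.
Proof. by move=> rk; rewrite mem_iota negb_and -ltnNge rk. Qed.

Lemma emits_consts R n b : R != 8 -> R \notin [:: 1; 2; 3; 4] -> R < 12 ->
  emits 8 R (iota 12 n) (Fors 8 (iota 12 n) (Push R b)) (loop_out 8 (iota 12 n) (fun=> [:: b])).
Proof.
move=> R8 R14 R12; rewrite -{1}[iota 12 n]cats0; apply: emits_fors; rewrite ?cats0 //.
- by rewrite eq_sym.
- by move=> r r5; apply: contraNneq R14 => <-; move: r5; do 5 (case: r => [|r] //).
- exact: iota_uniq.
- by apply/allP => v; rewrite mem_iota => /andP[h _]; apply: leq_trans h.
- exact: iota_notin.
- exact: iota_notin.
- exact: emits_push.
Qed.

Lemma run_stage1 : exists2 tau, polyb tau & forall w, let x := size w in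
  runs stage1 (regs [::] [::] w (nseq (base x) true) [::] [::] (nseq x true))
    (regs [::] [::] (binp w) (nseq (base x) true) (nseq (side x) true) (nseq (orig x) true)
       (nseq (orig x + x) true)) (tau x).
Proof.
have [_ [t1 p1 H1]] := @emits_consts 10 d true isT isT isT.
have [_ [t2 p2 H2]] := @emits_consts 9 d.+1 true isT isT isT.
have [_ [t3 p3 H3]] := @emits_consts 11 d true isT isT isT.
have [_ [t4 p4 H4]] := @emits_consts 6 d false isT isT isT.
have pb := polyb_big.
exists (fun x => t1 (size_bound x) + (t2 (size_bound x) + (t3 (size_bound x) + t4 (size_bound x)))).
  by repeat apply: polyb_add; apply: polyb_comp.
move=> w x; have bx : base x <= size_bound x.
  by rewrite /size_bound /base; lia.
have xb : x <= size_bound x by rewrite /size_bound; lia.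
have ob : orig x <= size_bound x by rewrite /size_bound; lia.
have sb : side x <= size_bound x by rewrite /size_bound; lia.
have n8 n : 8 \notin iota 12 n by apply: iota_notin.
apply: runs_seq; [|apply: runs_seq; [|apply: runs_seq]].
- apply: H1 => //; [exact: loops_empty | by apply: mk_bounded; rewrite ?size_nseq | by rewrite /regs /= size_nseq].
- set s := upd _ _ _; have -> : s = regs [::] [::] w (nseq (base x) true) [::] (nseq (orig x) true) (nseq x true).
    apply/funext; rewrite /s gs_const // {2}/regs /= size_nseq size_iota cats0; mk_tac.
  apply: H2 => //; [exact: loops_empty | by apply: mk_bounded; rewrite ?size_nseq | by rewrite /regs /= size_nseq].
- set s := upd _ _ _; have -> : s = regs [::] [::] w (nseq (base x) true) (nseq (side x) true) (nseq (orig x) true) (nseq x true).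
    apply/funext; rewrite /s gs_const // {2}/regs /= size_nseq size_iota cats0; mk_tac.
  apply: H3 => //; [exact: loops_empty | by apply: mk_bounded; rewrite ?size_nseq | by rewrite /regs /= size_nseq].
- set s := upd _ _ _; have -> : s = regs [::] [::] w (nseq (base x) true) (nseq (side x) true) (nseq (orig x) true) (nseq (orig x + x) true).
    apply/funext; rewrite /s gs_const // {2}/regs /= size_nseq size_iota -nseqD; mk_tac.
  apply: runs_ext (H4 _ (size_bound x) _ _ _ _) => //; [|exact: loops_empty | apply: mk_bounded; rewrite ?size_nseq // /size_bound; lia | by rewrite /regs /= size_nseq].
  rewrite gs_const // {2}/regs /= size_nseq size_iota; mk_tac.
Qed.

Definition fullst o m w : store := let x := size w in
  regs o m (binp w) (nseq (base x) true) (nseq (side x) true) (nseq (orig x) true)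
    (nseq (orig x + x) true).

Lemma index_iota_add a n k : k < n -> index (a + k) (iota a n) = k.
Proof.
move=> kn; rewrite -{1}(nth_iota 0 a kn); apply: index_uniq; rewrite ?size_iota //.
exact: iota_uniq.
Qed.

Lemma env_low x i j k : k < 6 ->
  env x i j k = nth 0 [:: orig x + x; 0; base x; side x; orig x; orig x + x] k.
Proof. by move=> k6; rewrite /env nth_cat /= k6. Qed.

Lemma env_x x i j k : k < D -> env x i j (6 + k) = digit (side x) D i k.
Proof. by move=> kD; rewrite /env nth_cat /= addKn nth_cat size_mkseq kD nth_mkseq. Qed.

Lemma env_y x i j k : k < D -> env x i j (6 + D + k) = digit (side x) D j k.
Proof.
move=> kD; rewrite /env nth_cat /= -addnA addKn nth_cat size_mkseq.
by rewrite ltnNge leq_addr /= addKn nth_mkseq.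
Qed.

Lemma env_high x i j k : 6 + D + D <= k -> env x i j k = 0.
Proof. by move=> kD; rewrite /env nth_default // !size_cat !size_mkseq /= addnA. Qed.

Lemma sval_asg o m w i j : i < verts (size w) -> j < verts (size w) ->
  sval (assign (side (size w)) ys (assign (side (size w)) xs (fullst o m w) i) j)
    = env (size w) i j.
Proof.
set x := size w => iv jv; apply/funext => k; rewrite /sval.
rewrite asgE ?iota_uniq ?size_iota // asgE ?iota_uniq ?size_iota // !mem_iota.
have [k6|k6] := ltnP k 6.
  rewrite env_low //.
  have -> : (12 + D <= data_reg k < 12 + D + D) = false by rewrite /data_reg; lia.
  have -> : (12 <= data_reg k < 12 + D) = false by rewrite /data_reg; lia.
  by move: k6; do 6 (case: k => [|k]; first by rewrite /fullst /regs /= ?size_cat ?size_nseq).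
have [kD|kD] := ltnP k (6 + D).
  have -> : (12 + D <= data_reg k < 12 + D + D) = false by rewrite /data_reg; lia.
  have -> : (12 <= data_reg k < 12 + D) = true by rewrite /data_reg; lia.
  have [q kE] : exists q, k = 6 + q by exists (k - 6); lia.
  rewrite kE env_x; last by lia.
  rewrite size_nseq -[data_reg (6 + q)]/(12 + q) index_iota_add //; lia.
have [kE|kE] := ltnP k (6 + D + D).
  have -> : (12 + D <= data_reg k < 12 + D + D) = true by rewrite /data_reg; lia.
  have [q kq] : exists q, k = 6 + D + q by exists (k - (6 + D)); lia.
  rewrite kq env_y; last by lia.
  have -> : data_reg (6 + D + q) = 12 + D + q by rewrite /data_reg; lia.
  rewrite size_nseq index_iota_add //; lia.
rewrite env_high //.
have -> : (12 + D <= data_reg k < 12 + D + D) = false by rewrite /data_reg; lia.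
have -> : (12 <= data_reg k < 12 + D) = false by rewrite /data_reg; lia.
by rewrite /fullst mk_high // /data_reg; lia.
Qed.

(** While only one vertex is enumerated, the empty registers [ys] read as the digits of 0. *)
Lemma sval_asg1 o m w i : i < verts (size w) ->
  sval (assign (side (size w)) xs (fullst o m w) i) = env (size w) i 0.
Proof.
move=> iv; rewrite -(sval_asg o m iv) //; last by apply: leq_ltn_trans iv.
apply/funext => k; rewrite /sval [in RHS]asgE ?iota_uniq ?size_iota //; last first.
  by apply: leq_ltn_trans iv.
case: ifP => // ky; rewrite asgE ?iota_uniq ?size_iota // size_nseq /digit div0n mod0n.
move: ky; rewrite !mem_iota => ky.
have -> : (12 <= data_reg k < 12 + D) = false by lia.
by rewrite /fullst mk_high //; lia.
Qed.

Lemma asg_low o m w i r : i < verts (size w) -> r < 12 ->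
  assign (side (size w)) xs (fullst o m w) i r = fullst o m w r.
Proof.
move=> iv r12; rewrite asgE ?iota_uniq ?size_iota // mem_iota.
by have -> : (12 <= r < 12 + D) = false by lia.
Qed.

Lemma asg_low2 o m w i j r : i < verts (size w) -> j < verts (size w) -> r < 12 ->
  assign (side (size w)) ys (assign (side (size w)) xs (fullst o m w) i) j r = fullst o m w r.
Proof.
move=> iv jv r12; rewrite asgE ?iota_uniq ?size_iota // mem_iota.
have -> : (12 + D <= r < 12 + D + D) = false by lia.
exact: asg_low.
Qed.

Lemma xs_gt : all (fun v => 5 < v) xs.
Proof. by apply/allP => v; rewrite mem_iota => /andP[h _]; apply: leq_trans h. Qed.

Lemma full_bounded o m w R : bounded (size_bound (size w)) R (fullst o m w).
Proof.
apply: mk_bounded; rewrite ?size_cat ?size_nseq /size_bound /base => _; lia.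
Qed.

Lemma run_stage2 : exists2 tau, polyb tau & forall w,
  runs stage2 (fullst [::] [::] w) (fullst (bins (pcount w)) [::] w) (tau (size w)).
Proof.
have [_ [t pt H]] : emits 9 5 xs (Fors 9 xs (Cond psi (Push 5 true) Skip))
    (loop_out 9 xs (fun s => nseq (store_eval psi s) true)).
  rewrite -{1}[xs]cats0; apply: emits_fors; rewrite ?cats0 //.
  - by do 5 (case => //).
  - exact: iota_uniq.
  - exact: xs_gt.
  - exact: iota_notin.
  - exact: iota_notin.
  - exact: emits_filter.
exists (fun x => t (size_bound x) + (verts x * (verts x * 10 + 13) + 1)).
  apply: polyb_add; first by apply: polyb_comp polyb_big.
  have pv : polyb verts by apply: polyb_exp polyb_side.
  by polyb_tac.
move=> w; set x := size w.
have r1 : runs (Fors 9 xs (Cond psi (Push 5 true) Skip)) (fullst [::] [::] w)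
    (fullst [::] (nseq (pcount w) true) w) (t (size_bound x)).
  apply: runs_ext (H _ (size_bound x) _ _ _ _) => //; last 1 first.
  - by rewrite /fullst /regs /= size_nseq.
  - have -> : loop_out 9 xs (fun s => nseq (store_eval psi s) true) (fullst [::] [::] w) = nseq (pcount w) true.
      rewrite (gs_asg _ (b := side x)); first last.
      - by rewrite /fullst /regs /= size_nseq.
      - exact: iota_notin.
      rewrite -flatten_nseq size_iota; congr flatten; apply/eq_in_map => i.
      rewrite mem_iota /= => iv; congr nseq; congr nat_of_bool.
      by rewrite /store_eval sval_asg1 // asg_low.
    by rewrite cats0 /fullst; mk_tac.
  - exact: loops_empty.
  - exact: full_bounded.
apply: runs_seq r1 _.
apply: runs_le (runs_ext _ (runs_tobin (m := pcount w) _ _ _)) _ => //.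
  by rewrite /fullst; mk_tac.
have : pcount w <= verts x by rewrite -[X in _ <= X](size_iota 0) count_size.
by move=> pv; rewrite addn1 ltnS; apply: leq_mul => //; lia.
Qed.

Lemma run_stage3 : exists2 tau, polyb tau & forall w,
  exists2 s, runs stage3 (fullst (bins (pcount w)) [::] w) s (tau (size w)) & s 0 = pout w.
Proof.
have [_ [t pt H]] : emits 9 0 (xs ++ ys)
   (Fors 9 xs (Fors 9 ys (Cond phi (Push 0 true) (Push 0 false))))
    (loop_out 9 xs (loop_out 9 ys (fun s => [:: store_eval phi s]))).
  have uxy : uniq (xs ++ ys) by rewrite /xs /ys -iotaD iota_uniq.
  apply: emits_fors => //.
  - by do 5 (case => //).
  - exact: xs_gt.
  - exact: iota_notin.
  - by rewrite mem_cat negb_or !iota_notin.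
  rewrite -{1}[ys]cats0; apply: emits_fors; rewrite ?cats0 //.
  - by do 5 (case => //).
  - exact: iota_uniq.
  - by apply/allP => v; rewrite mem_iota => /andP[h _]; apply: leq_trans h.
  - by apply: iota_notin; rewrite ltn_addr.
  - exact: iota_notin.
  - exact: emits_bev.
have [_ [t' pt' H']] : emits 9 0 xs (Fors 9 xs (Push 0 true)) (loop_out 9 xs (fun=> [:: true])).
  rewrite -{1}[xs]cats0; apply: emits_fors; rewrite ?cats0 //.
  - by do 5 (case => //).
  - exact: iota_uniq.
  - exact: xs_gt.
  - exact: iota_notin.
  - exact: iota_notin.
  - exact: emits_push.
exists (fun x => t (size_bound x) + (2 + t' (size_bound x))).
  by repeat apply: polyb_add; try exact: polyb_const; apply: polyb_comp polyb_big.
move=> w; set x := size w.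
pose mat := [seq beval phi (env x i j) (binp w) | i <- iota 0 (verts x), j <- iota 0 (verts x)].
have r1 : runs (Fors 9 xs (Fors 9 ys (Cond phi (Push 0 true) (Push 0 false))))
   (fullst (bins (pcount w)) [::] w) (fullst (mat ++ bins (pcount w)) [::] w) (t (size_bound x)).
  apply: runs_ext (H _ (size_bound x) _ _ _ _) => //; last 1 first.
  - by rewrite /fullst /regs /= size_nseq.
  - have -> : loop_out 9 xs (loop_out 9 ys (fun s => [:: store_eval phi s])) (fullst (bins (pcount w)) [::] w) = mat.
      rewrite (gs_asg _ (b := side x)); first last.
      - by rewrite /fullst /regs /= size_nseq.
      - exact: iota_notin.
      rewrite size_iota /mat; congr flatten; apply/eq_in_map => i; rewrite mem_iota /= => iv.
      rewrite (gs_asg _ (b := side x)); first last.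
      - by rewrite asg_low // /fullst /regs /= size_nseq.
      - by apply: iota_notin; rewrite ltn_addr.
      rewrite size_iota -[RHS]flatten_sing; congr flatten; apply/eq_in_map => j; rewrite mem_iota /= => jv.
      by congr [:: _]; rewrite /store_eval sval_asg // asg_low2.
    by rewrite /fullst; mk_tac.
  - by move=> v; rewrite mem_cat => /orP[]; apply: loops_empty => //; rewrite ltn_addr.
  - exact: full_bounded.
have r2 : runs (Push 0 false) (fullst (mat ++ bins (pcount w)) [::] w)
    (fullst (false :: mat ++ bins (pcount w)) [::] w) 2.
  by apply: runs_ext (runs_push _ _ _); rewrite /fullst; mk_tac.
eexists.
  apply: runs_seq r1 (runs_seq r2 (H' _ (size_bound x) _ _ _ _)) => //.
  - exact: loops_empty.
  - exact: full_bounded.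
  - by rewrite /fullst /regs /= size_nseq.
rewrite gs_const; last exact: iota_notin.
by rewrite /fullst /upd /regs /= size_nseq size_iota.
Qed.

Theorem pout_poly_computable : poly_computable pout.
Proof.
have [t1 p1 H1] := run_stage1; have [t2 p2 H2] := run_stage2; have [t3 p3 H3] := run_stage3.
pose tau x := (x * 7 + 1) + ((x * 11 + 1) + 2 * c0) + (t1 x + (t2 x + t3 x)).
have [k Hk] : polyb tau by rewrite /tau; polyb_tac.
apply: (@program_poly_computable prog _ k) => w.
have [s r3 s0] := H3 w.
have [n nt ex] := runs_seq (run_stage0 w) (runs_seq (H1 w) (runs_seq (H2 w) r3)).
exists s, n; split=> //; apply: leq_trans (Hk _); apply: leq_trans nt _; rewrite /tau; lia.
Qed.
End Program.

(** * Definable adjacency *)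

(* Variable 1 is the constant zero. *)
Definition definable (P : (nat -> nat) -> seq bool -> bool) :=
  exists e, forall val inp, val 1 = 0 -> beval e val inp = P val inp.

Section Definable.
Implicit Types P Q : (nat -> nat) -> seq bool -> bool.

Lemma def_const b : definable (fun _ _ => b).
Proof. by case: b; [exists BTrue | exists (BNot BTrue)]. Qed.

Lemma def_not P : definable P -> definable (fun val inp => ~~ P val inp).
Proof. by case=> e H; exists (BNot e) => val inp v1 /=; rewrite H. Qed.

Lemma def_and P Q : definable P -> definable Q -> definable (fun val inp => P val inp && Q val inp).
Proof. by move=> [e H] [e' H']; exists (BAnd e e') => val inp v1 /=; rewrite H // H'. Qed.

Lemma def_ext P Q : (forall val inp, val 1 = 0 -> P val inp = Q val inp) -> definable P -> definable Q.
Proof. by move=> PQ [e H]; exists e => val inp v1; rewrite H // PQ. Qed.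

Lemma def_or P Q : definable P -> definable Q -> definable (fun val inp => P val inp || Q val inp).
Proof.
move=> dP dQ; apply: def_ext (def_not (def_and (def_not dP) (def_not dQ))) => val inp _.
by rewrite negb_and !negbK.
Qed.

Lemma def_imp P Q : definable P -> definable Q -> definable (fun val inp => P val inp ==> Q val inp).
Proof.
by move=> dP dQ; apply: def_ext (def_or (def_not dP) dQ) => val inp _; rewrite implybE.
Qed.

Lemma def_if (R P Q : (nat -> nat) -> seq bool -> bool) : definable R -> definable P -> definable Q ->
  definable (fun val inp => if R val inp then P val inp else Q val inp).
Proof.
move=> dR dP dQ; apply: def_ext (def_or (def_and dR dP) (def_and (def_not dR) dQ)) => val inp _.
by case: (R val inp); rewrite /= ?orbF.
Qed.

Lemma def_all (T : Type) (P : T -> (nat -> nat) -> seq bool -> bool) (l : seq T) :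
  (forall x, definable (P x)) -> definable (fun val inp => all (fun x => P x val inp) l).
Proof. by move=> dP; elim: l => [|x l IH] /=; [exact: def_const | apply: def_and]. Qed.

Lemma def_forall (T : finType) (P : T -> (nat -> nat) -> seq bool -> bool) :
  (forall x, definable (P x)) -> definable (fun val inp => [forall x, P x val inp]).
Proof.
move=> dP; apply: def_ext (def_all (enum T) dP) => val inp _.
apply/allP/forallP => [H x|H x _]; last exact: H.
by apply: H; rewrite mem_enum.
Qed.

Lemma def_exists (T : finType) (P : T -> (nat -> nat) -> seq bool -> bool) :
  (forall x, definable (P x)) -> definable (fun val inp => [exists x, P x val inp]).
Proof.
move=> dP; apply: def_ext (def_not (def_forall (fun x => def_not (dP x)))) => val inp _.
by rewrite negb_forall; apply: eq_existsb => x; rewrite negbK.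
Qed.

Lemma def_bool3 (F : bool -> bool -> bool -> bool) (P Q R : (nat -> nat) -> seq bool -> bool) :
  definable P -> definable Q -> definable R -> definable (fun val inp => F (P val inp) (Q val inp) (R val inp)).
Proof.
move=> dP dQ dR.
apply: (@def_ext (fun val inp => if P val inp then
   if Q val inp then if R val inp then F true true true else F true true false
   else if R val inp then F true false true else F true false false
   else if Q val inp then if R val inp then F false true true else F false true false
   else if R val inp then F false false true else F false false false)).
  by move=> val inp _; case: (P _ _); case: (Q _ _); case: (R _ _).
by do 3 apply: def_if => //; exact: def_const.
Qed.

Lemma def_ltc c i d j : definable (fun val _ => c + val i < d + val j).
Proof. by exists (BLt c i d j). Qed.

Lemma def_lt i j : definable (fun val _ => val i < val j).
Proof. exact: (def_ltc 0 i 0 j). Qed.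

Lemma def_le i j : definable (fun val _ => val i <= val j).
Proof. exact: (def_ltc 0 i 1 j). Qed.

Lemma def_eqS c i d j : definable (fun val _ => c + val i == d + val j).
Proof.
apply: def_ext (def_and (def_not (def_ltc c i d j)) (def_not (def_ltc d j c i))) => val inp _.
by rewrite -!leqNgt eqn_leq andbC.
Qed.

Lemma def_eq i j : definable (fun val _ => val i == val j).
Proof. exact: (def_eqS 0 i 0 j). Qed.

Lemma def_eqn i n : definable (fun val _ => val i == n).
Proof. by apply: def_ext (def_eqS 0 i n 1) => val inp v1; rewrite v1 addn0. Qed.

Lemma def_bit i : definable (fun val inp => nth false inp (val i)).
Proof. by exists (BBit i). Qed.

Lemma def_same J (f f' : nat -> nat) : definable (fun val _ => same J (val \o f) (val \o f')).
Proof. by apply: def_forall => k; apply: def_eq. Qed.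

End Definable.

Section DefTrace.
Variables (M : TM) (f f' : nat -> nat).

Lemma def_rini (i : 'I_(extra M).+1) s (k : nat) :
  definable (fun val inp => rini (val 4) (val 5) inp i s (val k)).
Proof.
have din : definable (fun val inp => [&& i == ord0, val 4 <= val k & val k < val 5]).
  apply: def_and; first exact: def_const.
  by apply: def_and; [exact: def_le | exact: def_lt].
case: s => [[b|x]|] /=; [|exact: def_const|exact: def_not].
apply: def_and => //; case: b.
  by apply: def_ext (def_bit k) => val inp _; rewrite eqb_id.
by apply: def_ext (def_not (def_bit k)) => val inp _; rewrite eqbF_neg.
Qed.

Lemma def_unary (z : tab M) (g : nat -> nat) :
  definable (fun val inp => unary_ok (val 4) (val 5) (val 3) inp z (val \o g)).
Proof.
apply: def_and; first exact: def_const.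
apply: def_and.
  apply: def_imp; first exact: def_eqn.
  apply: def_and; first exact: def_const.
  by apply: def_forall => i; apply: def_eq.
apply: def_and.
  by apply: def_imp; [exact: (def_eqS 1 _ 0) | exact: def_const].
apply: def_forall => i; apply: def_and; first exact: def_le.
by apply: def_imp; [exact: def_eqn | exact: def_rini].
Qed.

Lemma def_binary (z z' : tab M) (g g' : nat -> nat) :
  definable (fun val inp => binary_ok z z' (val \o g) (val \o g')).
Proof.
apply: def_and; last by apply: def_imp; [exact: (def_eqS 0 _ 1) | exact: def_const].
apply: def_forall => i; apply: def_and.
  apply: def_imp; first exact: (def_eqS 0 _ 1).
  by apply: def_and; [exact: def_eq | exact: def_const].
apply: def_and.
  by apply: def_imp; [exact: def_le | apply/def_not/def_eq].
apply: def_imp; first exact: (def_eqS 0 _ 1).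
case: (mv z i) => /=; [exact: (def_eqS 0 _ 1) | exact: def_eq | exact: (def_eqS 0 _ 1)].
Qed.

(** The quantifiers range over local data and tapes of the fixed machine; they expand into finite
    disjunctions and conjunctions. *)
Lemma def_rE : definable (fun val inp => trace_rel M (val 4) (val 5) (val 3) inp (val \o f) (val \o f')).
Proof.
apply: def_exists => z; apply: def_exists => z'.
apply: def_and; first exact: def_eqn.
apply: def_and; first exact: def_eqn.
apply: def_and; first exact: def_unary.
apply: def_and; first exact: def_unary.
apply: def_or; first exact: def_same.
by apply: def_or; apply: def_and; solve [exact: def_lt | exact: def_binary].
Qed.
End DefTrace.

(* The coordinates of a vertex are a tag, two points u and z with J coordinates
   each, and three further numbers. *)
Section Kinds.
Variable M : TM.
Local Notation J := (ncoord M).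
Definition vdim := (J + J).+4.

Definition cut (a : nat) (f : nat -> nat) (k : nat) := if k < J then f (a + k) else 0.
Definition upart := cut 1.
Definition zpart := cut J.+1.
Definition zero (f : nat -> nat) := [forall k : 'I_J, f k == 0].
(** A set of exactly [B] points that digit tests recognise; leaving it out yields the factor |V| - k
    of [L]. *)
Definition axis (f : nat -> nat) := [forall k : 'I_J, (k == 0 :> nat) || (f k == 0)].

Section Raw.
Variables (P0 END B : nat) (inp : seq bool).

(* The conditions fix the sizes of the classes: with N = B ^ J points the classes
   0-3 have (N - B) * B ^ 3 vertices each, class 4 has B ^ 2, each class 5 has
   B ^ 3, each class 6 one vertex, and class 7 takes the rest. *)
Definition kcond (a : nat) (f : nat -> nat) : bool :=
  match a with
  | 0 => ~~ axis (zpart f)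
  | 1 | 2 | 3 => zero (upart f) && ~~ axis (zpart f)
  | 4 => [&& zero (upart f), zero (zpart f) & f (J + J).+3 == 0]
  | 5 => zero (zpart f)
  | 6 => [&& trace_rel M P0 END B inp (upart f) (zpart f), f (J + J).+1 == 0,
             f (J + J).+2 == 0 & f (J + J).+3 == 0]
  | _ => false
  end.

(** A vertex that fails the condition of its tag joins the hub. *)
Definition kind (f : nat -> nat) : nat := if kcond (f 0) f then f 0 else 7.

Definition incb (o q : nat) (e e' : bool) : bool :=
  match o with
  | 0 => if q == 5 then e else if q == 6 then e || e' else false
  | 1 | 2 => q != 5
  | 3 => q == 5
  | _ => q != 6
  end.

Definition linkb (k k' : nat) (uu uz zu : bool) : bool :=
  if k < 5 then if k' < 5 then (k == k') && ((k == 0) ==> uu) else incb k k' uu uz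
  else if k' < 5 then incb k' k uu zu else true.

Definition radj (f f' : nat -> nat) : bool :=
  ~~ same vdim f f' &&
  linkb (kind f) (kind f') (same J (upart f) (upart f')) (same J (upart f) (zpart f'))
    (same J (zpart f) (upart f')).

End Raw.

Lemma kind_le P0 END B inp f : kind P0 END B inp f < 8.
Proof. by rewrite /kind; case: ifP => //; case: (f 0) => [|[|[|[|[|[|[|k]]]]]]]. Qed.

(** Variable 1 is zero and supplies the default value of [cut]. *)
Definition cutix (a c : nat) (k : nat) := if k < J then a + (c + k) else 1.

Lemma cutixE (val : nat -> nat) a c : val 1 = 0 ->
  cut c (fun k => val (a + k)) = val \o cutix a c.
Proof. by move=> v1; apply/funext => k; rewrite /cut /cutix /=; case: ifP. Qed.

Lemma def_kcond a o : definable (fun val inp => kcond (val 4) (val 5) (val 3) inp a (fun k => val (o + k))).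
Proof.
have dz c : definable (fun val inp => zero (cut c (fun k => val (o + k)))).
  apply: (@def_ext (fun val inp => zero (val \o cutix o c))).
    by move=> val inp v1; rewrite cutixE.
  by apply: def_forall => k; apply: def_eqn.
have da c : definable (fun val inp => axis (cut c (fun k => val (o + k)))).
  apply: (@def_ext (fun val inp => axis (val \o cutix o c))).
    by move=> val inp v1; rewrite cutixE.
  by apply: def_forall => k; apply: def_or; [exact: def_const | exact: def_eqn].
case: a => [|[|[|[|[|[|[|a]]]]]]] /=.
- exact/def_not/da.
- by apply: def_and; [exact: dz | exact/def_not/da].
- by apply: def_and; [exact: dz | exact/def_not/da].
- by apply: def_and; [exact: dz | exact/def_not/da].
- by do 2 (apply: def_and; first exact: dz); apply: def_eqn.
- exact: dz.
- apply: def_and; last first.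
    by do 2 (apply: def_and; first exact: def_eqn); apply: def_eqn.
  apply: (@def_ext (fun val inp => trace_rel M (val 4) (val 5) (val 3) inp
    (val \o cutix o 1) (val \o cutix o J.+1))); last exact: def_rE.
  by move=> val inp v1; rewrite /upart /zpart !cutixE.
- exact: def_const.
Qed.

Lemma def_kind a o : definable (fun val inp =>
  kind (val 4) (val 5) (val 3) inp (fun k => val (o + k)) == a).
Proof.
pose Q (b : 'I_7) (val : nat -> nat) (inp : seq bool) := (val (o + 0) == b :> nat) &&
  kcond (val 4) (val 5) (val 3) inp b (fun k => val (o + k)).
have dQ b : definable (Q b) by apply: def_and; [exact: def_eqn | exact: def_kcond].
apply: (@def_ext (fun val inp => [exists b : 'I_7, (b == a :> nat) && Q b val inp] ||
   ((a == 7) && ~~ [exists b : 'I_7, Q b val inp]))); last first.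
  apply: def_or; first by apply: def_exists => b; apply: def_and; [exact: def_const|].
  by apply: def_and; [exact: def_const | apply/def_not/def_exists].
move=> val inp _; rewrite /kind; set f := fun k => val (o + k).
rewrite -[val (o + 0)]/(f 0).
case: ifP => kc.
  have f7 : f 0 < 7 by case: (f 0) kc => [|[|[|[|[|[|[|k]]]]]]].
  have q : Q (Ordinal f7) val inp by rewrite /Q /= eqxx.
  have -> : [exists b, Q b val inp] by apply/existsP; exists (Ordinal f7).
  rewrite andbF orbF; apply/existsP/eqP => [[b /andP[/eqP <- /andP[/eqP]]] //|<-].
  by exists (Ordinal f7); rewrite eqxx.
have nq b : Q b val inp = false.
  by apply/negP => /andP[/eqP e]; rewrite -e -[val (o + 0)]/(f 0) kc.
have -> : [exists b, Q b val inp] = false by apply/existsP => -[b]; rewrite nq.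
rewrite andbT eq_sym; apply: orb_idl => /existsP[b]; by rewrite nq andbF.
Qed.

Lemma def_radj o o' : definable (fun val inp =>
  radj (val 4) (val 5) (val 3) inp (fun k => val (o + k)) (fun k => val (o' + k))).
Proof.
have ds c c' : definable (fun val inp => same J (cut c (fun k => val (o + k))) (cut c' (fun k => val (o' + k)))).
  apply: (@def_ext (fun val inp => same J (val \o cutix o c) (val \o cutix o' c'))).
    by move=> val inp v1; rewrite !cutixE.
  exact: def_same.
apply: def_and; first by apply/def_not/def_forall => k; apply: def_eq.
pose S c c' (val : nat -> nat) (inp : seq bool) :=
  same J (cut c (fun k => val (o + k))) (cut c' (fun k => val (o' + k))).
apply: (@def_ext (fun val inp => [exists b : 'I_8, exists b' : 'I_8,
  [&& kind (val 4) (val 5) (val 3) inp (fun k => val (o + k)) == b,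
      kind (val 4) (val 5) (val 3) inp (fun k => val (o' + k)) == b' &
      linkb b b' (S 1 1 val inp) (S 1 J.+1 val inp) (S J.+1 1 val inp)]])); last first.
  apply: def_exists => b; apply: def_exists => b'.
  apply: def_and; first exact: def_kind.
  apply: def_and; first exact: def_kind.
  by apply: (@def_bool3 (linkb b b')); apply: ds.
move=> val inp _; set k1 := kind _ _ _ _ _; set k2 := kind _ _ _ _ _.
have h1 : k1 < 8 by exact: kind_le.
have h2 : k2 < 8 by exact: kind_le.
apply/existsP/idP => [[b /existsP[b' /and3P[/eqP-> /eqP-> //]]]|l].
by exists (Ordinal h1); apply/existsP; exists (Ordinal h2); rewrite !eqxx.
Qed.

Lemma def_isq o : definable (fun val inp =>
  4 < kind (val 4) (val 5) (val 3) inp (fun k => val (o + k))).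
Proof.
apply: (@def_ext (fun val inp => [exists b : 'I_8, (4 < b) &&
   (kind (val 4) (val 5) (val 3) inp (fun k => val (o + k)) == b)])); last first.
  by apply: def_exists => b; apply: def_and; [exact: def_const | exact: def_kind].
move=> val inp _; set k1 := kind _ _ _ _ _; have h1 : k1 < 8 by exact: kind_le.
apply/existsP/idP => [[b /andP[b4 /eqP->]] //|l].
by exists (Ordinal h1); rewrite eqxx andbT.
Qed.
End Kinds.

(** * The reduction *)

Lemma same_sym J f f' : same J f f' = same J f' f.
Proof. by apply: eq_forallb => k; rewrite eq_sym. Qed.

Lemma linkb_sym k k' uu uz zu : linkb k k' uu uz zu = linkb k' k uu zu uz.
Proof.
rewrite /linkb; case: ltnP => h; case: ltnP => h' //.
by rewrite eq_sym; case: eqP => // ->.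
Qed.

Lemma radj_sym M P0 END B inp f f' : radj M P0 END B inp f f' = radj M P0 END B inp f' f.
Proof.
rewrite /radj same_sym linkb_sym; congr (_ && linkb _ _ _ _ _); exact: same_sym.
Qed.

Lemma same_refl J f : same J f f.
Proof. by apply/forallP. Qed.

Lemma dig_inj b D i i' : i < b ^ D -> i' < b ^ D ->
  (forall k, k < D -> digit b D i k = digit b D i' k) -> i = i'.
Proof.
elim: D i i' => [|D IH] i i'; first by rewrite expn0 !ltnS !leqn0 => /eqP-> /eqP->.
rewrite expnS => ib ib' H.
have b0 : 0 < b ^ D by case: (b ^ D) ib; rewrite ?muln0.
rewrite (divn_eq i (b ^ D)) (divn_eq i' (b ^ D)); congr (_ * _ + _).
  have := H 0 isT; rewrite /digit subSS subn0 !modn_small //; by rewrite ltn_divLR.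
apply: IH; rewrite ?ltn_mod // => k kD; rewrite !dig_mod //; exact: H.
Qed.

Definition class_of_kind (V : finType) (k : nat) (u z : V) : cls V :=
  match k with
  | 0 => inl (inl u)
  | 1 => inl (o1 V)
  | 2 => inl (oy V)
  | 3 => inl (o2 V)
  | 4 => inl (oh V)
  | 5 => inr (inr (inl u))
  | 6 => inr (inl (u, z))
  | _ => inr (inr (inr tt))
  end.

Lemma link_mkcls (V : finType) k k' (u z u' z' : V) : k < 8 -> k' < 8 ->
  link (class_of_kind k u z) (class_of_kind k' u' z') = linkb k k' (u == u') (u == z') (z == u').
Proof.
case: k => [|[|[|[|[|[|[|[|k]]]]]]]] // _; case: k' => [|[|[|[|[|[|[|[|k']]]]]]]] // _ //=.
by rewrite /linkb /= ![u' == _]eq_sym.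
Qed.

(** * Class sizes in the concrete graph *)

Section Concrete.
Variables (M : TM) (P0 END B : nat) (inp : seq bool).
Hypothesis B8 : 7 < B.
Local Notation J := (ncoord M).
Local Notation D := (vdim M).
Local Notation n := (B ^ D).
Local Notation V := {ffun 'I_J -> 'I_B}.
Local Notation knd := (kind M P0 END B inp).

Definition cgraph : sgraph 'I_n.
Proof.
refine (@SGraph _ (fun i j : 'I_n => radj M P0 END B inp (digit B D i) (digit B D j)) _ _).
- by move=> i j; apply: radj_sym.
- by move=> i; rewrite /radj same_refl.
Defined.

Lemma B_gt0 : 0 < B. Proof. exact: leq_trans B8. Qed.
Definition b0 : 'I_B := Ordinal B_gt0.
Definition v0 : V := [ffun=> b0].
Definition vec (f : nat -> nat) : V := [ffun k : 'I_J => insubd b0 (f k)].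

Lemma dig_lt i k : digit B D i k < B. Proof. by rewrite ltn_mod B_gt0. Qed.

Lemma co_vec a i : coords (vec (cut M a (digit B D i))) = cut M a (digit B D i).
Proof.
apply/funext => k; rewrite /coords; case: insubP => [k' _ <-|kJ].
  rewrite ffunE insubdK // /cut ltn_ord; exact: dig_lt.
by rewrite /cut (negPf kJ).
Qed.

Lemma zero_co (u : V) : zero M (coords u) = (u == v0).
Proof.
apply/forallP/eqP => [H|-> k]; last by rewrite co_ord ffunE.
apply/ffunP => k; apply: val_inj; rewrite ffunE /=; apply/eqP.
by have := H k; rewrite co_ord.
Qed.

Definition grid_edge : rel V := fun u v => trace_rel M P0 END B inp (coords u) (coords v).
Definition ax : {set V} := [set z | axis M (coords z)].

(** On tuples the classes become products of sets, whose sizes multiply; [dec] carries the counts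
    over to vertex numbers. *)
Definition xtype := ('I_B * V * V * ('I_B * 'I_B * 'I_B))%type.
Implicit Type x : xtype.

Definition xcond (a : nat) x : bool :=
  let: (_, u, z, (p, q, r)) := x in
  match a with
  | 0 => z \notin ax
  | 1 | 2 | 3 => (u == v0) && (z \notin ax)
  | 4 => [&& u == v0, z == v0 & r == b0]
  | 5 => z == v0
  | 6 => [&& grid_edge u z, p == b0, q == b0 & r == b0]
  | _ => false
  end.
Definition xkind x : nat := if xcond x.1.1.1 x then x.1.1.1 : nat else 7.
Definition xcls x : cls V := class_of_kind (xkind x) x.1.1.2 x.1.2.

Definition ordB (k : nat) : 'I_B := insubd b0 k.
Definition dec (i : 'I_n) : xtype :=
  let f := digit B D i in
  (ordB (f 0), vec (upart M f), vec (zpart M f), (ordB (f (J + J).+1), ordB (f (J + J).+2), ordB (f (J + J).+3))).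

Lemma val_ordB i k : ordB (digit B D i k) = digit B D i k :> nat.
Proof. by rewrite insubdK //; apply: dig_lt. Qed.

Lemma kind_dec (i : 'I_n) : knd (digit B D i) = xkind (dec i).
Proof.
rewrite /kind /xkind /= val_ordB.
suff -> : forall a, kcond M P0 END B inp a (digit B D i) = xcond a (dec i) by [].
move=> a; rewrite /dec; set f := digit B D i.
have r0 k : (ordB (f k) == b0) = (f k == 0).
  by rewrite -[LHS](inj_eq val_inj) /= val_ordB.
case: a => [|[|[|[|[|[|[|a]]]]]]] /=; rewrite ?inE -?zero_co ?r0 /upart /zpart ?co_vec //.
by rewrite /grid_edge !co_vec.
Qed.

Lemma dec_inj : injective dec.
Proof.
move=> i i' [/(congr1 val) + /(congr1 (@coords _ _)) + /(congr1 (@coords _ _)) +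
  /(congr1 val) + /(congr1 val) + /(congr1 val)].
rewrite /= !val_ordB /upart /zpart !co_vec => e0 eu ez e1 e2 e3.
apply: val_inj; apply: dig_inj (ltn_ord i) (ltn_ord i') _ => k kD.
case: k kD => [//|k]; rewrite /vdim !ltnS => kD.
have [kJ|kJ] := ltnP k J; first by have := congr1 (@^~ k) eu; rewrite /cut kJ.
have [kJ2|kJ2] := ltnP k (J + J).
  have := congr1 (@^~ (k - J)) ez; rewrite /cut (_ : k - J < J); last by lia.
  by rewrite addSn subnKC.
have [->//|[->//|->//]] : k = J + J \/ k = (J + J).+1 \/ k = (J + J).+2 by lia.
Qed.

Lemma card_V : #|{: V}| = B ^ J.
Proof. by rewrite card_ffun !card_ord. Qed.

Lemma dec_bij : bijective dec.
Proof.
apply: inj_card_bij dec_inj _.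
rewrite !card_prod card_V !card_ord /vdim.
have -> : (J + J).+4 = 1 + J + J + (1 + 1 + 1) by lia.
by rewrite !expnD !expn1.
Qed.

Definition ccls (i : 'I_n) : cls V :=
  class_of_kind (knd (digit B D i)) (vec (upart M (digit B D i))) (vec (zpart M (digit B D i))).

Lemma ccls_dec i : ccls i = xcls (dec i).
Proof. by rewrite /ccls kind_dec. Qed.

Lemma same_vec a a' i i' :
  same J (cut M a (digit B D i)) (cut M a' (digit B D i')) =
  (vec (cut M a (digit B D i)) == vec (cut M a' (digit B D i'))).
Proof. by rewrite -same_co !co_vec. Qed.

Lemma cadjE i i' : adj cgraph i i' = (i != i') && link (ccls i) (ccls i').
Proof.
rewrite /cgraph /= /radj /ccls link_mkcls ?kind_le // /upart /zpart !same_vec; congr (~~ _ && _).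
apply/forallP/eqP => [H|-> k //]; apply: val_inj.
apply: dig_inj (ltn_ord i) (ltn_ord i') _ => k kD.
exact/eqP/(H (Ordinal kD)).
Qed.

Lemma cwtE d : wt ccls d = #|[set x | xcls x == d]|.
Proof.
rewrite -(@on_card_preimset _ _ dec); last exact/onW_bij/dec_bij.
by apply: eq_card => i; rewrite !inE ccls_dec.
Qed.

Lemma card_ax : #|ax| = B.
Proof.
pose h (t : 'I_B) : V := [ffun k : 'I_J => if k == 0 :> nat then t else b0].
have hi : injective h.
  by move=> t t' /ffunP/(_ ord0); rewrite !ffunE.
rewrite -[RHS]card_ord -cardsT -(card_imset setT hi); apply: eq_card => z.
rewrite inE; apply/forallP/imsetP => [H|[t _ ->] k].
  exists (z ord0) => //; apply/ffunP => k; rewrite ffunE; have := H k; rewrite co_ord.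
  case: eqP => [k0 _|_ /eqP zk]; last exact: val_inj.
  by congr (z _); apply: val_inj.
by rewrite co_ord ffunE; case: eqP.
Qed.

Lemma card_axC : #|~: ax| = B ^ J - B.
Proof. by rewrite cardsCs setCK card_ax card_V. Qed.

Lemma xkind_eq a x : a < 7 -> (xkind x == a) = (x.1.1.1 == a :> nat) && xcond a x.
Proof.
move=> a7; rewrite /xkind; case: ifP => c; first by case: eqP => // <-; rewrite c.
rewrite eq_sym (ltn_eqF a7); case: eqP => // e; by rewrite -e c.
Qed.

Lemma xkind_le x : xkind x < 8.
Proof.
rewrite /xkind; case: ifP => //; move: x => [[[t u] z] [[p q] r]] /=.
by case: (t : nat) => [|[|[|[|[|[|[|k]]]]]]].
Qed.

Definition tag_ord (k : nat) := ordB k.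
Lemma tagE (t : 'I_B) k : k < 8 -> (t == k :> nat) = (t == tag_ord k).
Proof.
move=> k8; rewrite -[RHS](inj_eq val_inj) /= insubdK //; exact: leq_trans B8.
Qed.

Local Notation L := (B * B * B * (B ^ J - B)).

Lemma card_box (T U Z P : {set _}) : 
  #|setX (setX (setX (T : {set 'I_B}) (U : {set V})) (Z : {set V})) (P : {set 'I_B * 'I_B * 'I_B})|
   = #|T| * #|U| * #|Z| * #|P|.
Proof. by rewrite !cardsX. Qed.

Lemma card_cube : #|[set: 'I_B * 'I_B * 'I_B]| = B * B * B.
Proof. by rewrite cardsT !card_prod card_ord. Qed.

Lemma mkcls_eq (k : nat) (u z : V) d : k < 8 -> (class_of_kind k u z == d) =
  match d with
  | inl (inl v) => (k == 0) && (u == v)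
  | inl (inr (b, b')) => k == 1 + b' + b.*2
  | inr (inl (v, v')) => [&& k == 6, u == v & z == v']
  | inr (inr (inl v)) => (k == 5) && (u == v)
  | inr (inr (inr _)) => k == 7
  end.
Proof.
case: k => [|[|[|[|[|[|[|[|k]]]]]]]] // _;
  by case: d => [[v|[[] []]]|[[v v']|[v|[]]]].
Qed.

Lemma wt_O (o : ocls V) : o != oh V -> wt ccls (inl o) = L.
Proof.
rewrite cwtE => no.
have [t [U [t8 U1 H]]] : exists t (U : {set V}), [/\ t < 8, #|U| = 1 &
    forall x, (xcls x == inl o) = [&& x.1.1.1 == t :> nat, x.1.1.2 \in U & x.1.2 \notin ax]].
  case: o no => [v|[b b']] no.
    exists 0, [set v]; split; rewrite ?cards1 // => x; rewrite mkcls_eq ?xkind_le // xkind_eq //.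
    move: x => [[[t u] z] [[p q] r]] /=.
    by rewrite in_set1 -andbA; congr andb; rewrite andbC.
  exists (1 + b' + b.*2), [set v0]; split; rewrite ?cards1 //; first by case: b b' {no} => [] [].
  move=> x; rewrite mkcls_eq ?xkind_le // xkind_eq; last by case: b b' no => [] [].
  move: x => [[[t u] z] [[p q] r]] /=; rewrite in_set1.
  by case: b b' no => [] [].
have -> : [set x | xcls x == inl o] = setX (setX (setX [set tag_ord t] U) (~: ax)) setT.
  apply/setP => -[[[t' u] z] pqr]; rewrite inE H !in_setX !inE tagE // andbT.
  by rewrite -andbA.
by rewrite card_box cards1 U1 card_axC card_cube !mul1n mulnC.
Qed.

Lemma wt_h : wt ccls (inl (oh V)) = B * B.
Proof.
rewrite cwtE; have -> : [set x | xcls x == inl (oh V)] =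
    setX (setX (setX [set tag_ord 4] [set v0]) [set v0]) (setX setT [set b0]).
  apply/setP => x; rewrite inE.
  have -> : (xcls x == inl (oh V)) = (xkind x == 4) by rewrite mkcls_eq ?xkind_le.
  rewrite xkind_eq //.
  move: x => [[[t u] z] [[p q] r]]; rewrite !in_setX !inE /= tagE //.
  by rewrite -!andbA.
by rewrite card_box !cards1 cardsX cards1 cardsT card_prod card_ord !mul1n muln1.
Qed.

Lemma wt_qv v : wt ccls (inr (inr (inl v))) = B * B * B.
Proof.
rewrite cwtE; have -> : [set x | xcls x == inr (inr (inl v))] =
    setX (setX (setX [set tag_ord 5] [set v]) [set v0]) setT.
  apply/setP => x; rewrite inE mkcls_eq ?xkind_le // xkind_eq //.
  move: x => [[[t u] z] [[p q] r]]; rewrite !in_setX !inE /= tagE //.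
  by rewrite andbT -!andbA; congr andb; rewrite andbC.
by rewrite card_box !cards1 card_cube !mul1n.
Qed.

Lemma wt_qe u v : wt ccls (inr (inl (u, v))) = grid_edge u v :> nat.
Proof.
rewrite cwtE; have -> : [set x | xcls x == inr (inl (u, v))] =
    if grid_edge u v then setX (setX (setX [set tag_ord 6] [set u]) [set v]) (setX (setX [set b0] [set b0]) [set b0])
    else set0.
  apply/setP => x; rewrite inE mkcls_eq ?xkind_le // xkind_eq //.
  move: x => [[[t u'] z] [[p q] r]] /=; case: ifP => e; rewrite ?in_setX !inE /= ?tagE //.
    rewrite -!andbA; congr andb.
    have [->|] := eqVneq u' u; last by rewrite !andbF.
    have [->|] := eqVneq z v; last by rewrite !andbF.
    by rewrite e /= andbT.
  have [->|] := eqVneq u' u; last by rewrite !andbF.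
  have [->|] := eqVneq z v; last by rewrite !andbF.
  by rewrite e andbF.
by case: ifP => _; rewrite ?cards0 // card_box !cards1 !cardsX !cards1.
Qed.

Lemma wt_qh : L <= wt ccls (inr (inr (inr tt))).
Proof.
rewrite cwtE.
have -> : L = #|setX (setX (setX [set tag_ord 7] [set v0]) (~: ax)) [set: 'I_B * 'I_B * 'I_B]|.
  by rewrite card_box !cards1 card_axC card_cube !mul1n mulnC.
apply: subset_leq_card; apply/subsetP => -[[[t u] z] pqr]; rewrite !in_setX !inE mkcls_eq ?xkind_le //.
(* No condition holds for tag 7, so vertices with this tag are in the hub; a box of size [L] among
   them suffices. *)
rewrite -!andbA => /andP[t7 _]; rewrite /xkind; case: ifP => // _.
by rewrite tagE.
Qed.

Theorem cgraph_winnable :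
  winnable cgraph #|[set i : 'I_n | 4 < knd (digit B D i)]| <->
  exists2 U : {set V}, #|U| <= B & B * B <= epairs grid_edge U.
Proof.
have -> : [set i : 'I_n | 4 < knd (digit B D i)] = qv ccls.
  apply/setP => i; rewrite !inE /ccls; have := kind_le M P0 END B inp (digit B D i).
  by case: (knd _) => [|[|[|[|[|[|[|[|k]]]]]]]].
have BJ : B * B <= B ^ J by rewrite mulnn leq_pexp2l ?B_gt0 // /ncoord; lia.
(* [c] is k^2 for k = [B], obtained from two free digits; the third free digit makes [a] the cube of
   [B], so that [c <= a]. *)
apply: (@gadget V grid_edge B (B * B * B) L (B * B) _ cgraph ccls cadjE wt_O wt_h wt_qe wt_qv wt_qh).
- by rewrite card_V.
- by rewrite -muln2; apply: (@leq_trans (B * B * B)); [apply: leq_mul; lia | rewrite leq_pmulr //; nia].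
- by rewrite leq_pmulr // B_gt0.
- by rewrite muln_gt0 B_gt0.
- rewrite card_V; apply: leq_trans BJ; nia.
Qed.

End Concrete.

(** * Binary numerals and the encoding of instances *)

Lemma binary_cons (b : bool) m : 0 < m -> binary (b + m.*2) = b :: binary m.
Proof.
move=> m0; rewrite /binary trunc_log2S; last by lia.
have -> : (b + m.*2)./2 = m by rewrite half_bit_double.
apply: (@eq_from_nth _ false) => [|[|i]].
- by rewrite size_mkseq; exact: (congr1 S (esym (size_mkseq _ _))).
- by move=> _; rewrite nth_mkseq // expn0 divn1 oddD odd_double addbF oddb.
rewrite size_mkseq => iN; rewrite -[nth _ (b :: _) _]/(nth false (mkseq _ _) i) !nth_mkseq //.
by rewrite expnS divnMA divn2 half_bit_double.
Qed.

Lemma bit_double_split m : 1 < m -> exists (b : bool) m', [/\ m = b + m'.*2, 0 < m' & m' < m].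
Proof.
move=> m1; exists (odd m), m./2; split; first by rewrite odd_double_half.
  by rewrite half_gt0.
by rewrite -divn2 ltn_Pdiv // ltnW.
Qed.

Lemma binary_succ m : 0 < m -> binary m.+1 = binc (binary m).
Proof.
elim/ltn_ind: m => m IH m0; have [m1|m1] := leqP m 1; first by have -> : m = 1 by lia.
have [[] [m' [mE m'0 m'm]]] := bit_double_split m1; rewrite mE.
  have -> : (true + m'.*2).+1 = false + (m'.+1).*2 by rewrite doubleS.
  by rewrite !binary_cons //= IH.
have -> : (false + m'.*2).+1 = true + m'.*2 by [].
by rewrite !binary_cons.
Qed.

Lemma binsE m : 0 < m -> bins m = binary m.
Proof.
elim: m => // m IH _; case: m IH => // m IH.
by rewrite binary_succ // -IH.
Qed.

Lemma binary_inj m m' : 0 < m -> 0 < m' -> binary m = binary m' -> m = m'.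
Proof.
pose v := foldr (fun (b : bool) x => b + x.*2) 0.
suff K k : 0 < k -> v (binary k) = k by move=> m0 m'0 e; rewrite -[LHS]K // e K.
elim/ltn_ind: k => k IH k0; have [k1|k1] := leqP k 1; first by have -> : k = 1 by lia.
have [b [k' [kE k'0 k'k]]] := bit_double_split k1.
by rewrite kE binary_cons // -[LHS]/(b + (v (binary k')).*2) IH.
Qed.

Lemma nseq_false_inj n n' (r r' : seq bool) :
  nseq n true ++ false :: r = nseq n' true ++ false :: r' -> n = n' /\ r = r'.
Proof.
elim: n n' => [|n IH] [|n'] //=; first by case.
by case=> /IH [-> ->].
Qed.

Lemma sgraph_ext (V : finType) (G G' : sgraph V) : adj G =2 adj G' -> G = G'.
Proof.
case: G G' => [a s i] [a' s' i'] /= e.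
have aa : a = a' by apply/funext => x; apply/funext => y; apply: e.
move: s i s' i'; rewrite aa => s i s' i'.
by congr SGraph; apply: Prop_irrelevance.
Qed.

(** [FireFighting] asks for some decoding of the word, so correctness of the reduction needs that
    there is only one. The unary prefix fixes n and with it the length of the matrix. *)
Lemma encode_inj n n' (G : sgraph 'I_n) (G' : sgraph 'I_n') m m' :
  0 < m -> 0 < m' -> encode G m = encode G' m' ->
  exists e : n = n', eq_rect n (fun k => sgraph 'I_k) G n' e = G' /\ m = m'.
Proof.
move=> m0 m'0 /nseq_false_inj [nn]; subst n'.
move/eqP; rewrite eqseq_cat ?size_allpairs // => /andP[/eqP eA /eqP eB].
exists erefl; split; last exact: binary_inj.
by apply: sgraph_ext => i j; move/eq_in_allpairs: eA; apply; rewrite mem_enum.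
Qed.

Lemma FireFighting_encode n (G : sgraph 'I_n) m : 0 < m ->
  FireFighting (encode G m) <-> winnable G m.
Proof.
move=> m0; rewrite -ffn_le; split=> [[n' [G' [m' [m'0 e le]]]]|le]; last by exists n, G, m.
have [nn [GG mm]] := encode_inj m0 m'0 e; subst n'; move: le; rewrite -GG -mm.
by [].
Qed.

Lemma count_ord n (P : pred nat) : count P (iota 0 n) = #|[set i : 'I_n | P i]|.
Proof.
rewrite -val_enum_ord count_map -sum1_count big_enum_cond /= -sum1_card.
by apply: eq_bigl => i; rewrite inE.
Qed.

Lemma leq_exp x y i n : x <= y -> 0 < y -> i <= n -> x ^ i <= y ^ n.
Proof.
move=> xy y0 il; apply: (@leq_trans (y ^ i)); last by rewrite leq_pexp2l.
by case: i {il} => // i; rewrite leq_exp2r.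
Qed.

Lemma horner_nat_bound (p : {poly nat}) : exists c d, forall x, (p.[x])%R <= (x + c) ^ d.
Proof.
pose C := \sum_(i < size p) (p`_i)%R.
(* The extra factor of the power absorbs the sum [C] of the coefficients. *)
exists (C + 1), (size p).+1 => x; rewrite horner_coef.
apply: (@leq_trans (\sum_(i < size p) (p`_i)%R * (x + (C + 1)) ^ size p)).
  apply: leq_sum => i _; apply: leq_mul => //.
  have -> : (x ^+ i)%R = x ^ i by elim: (i : nat) => // j IH; rewrite GRing.exprS IH expnS.
  by apply: leq_exp; [exact: leq_addr | rewrite addnA addn1 | exact: ltnW].
rewrite -big_distrl /= expnS leq_mul2r; apply/orP; right; rewrite -/C; lia.
Qed.

Section Extensionality.
Variables (M : TM) (P0 END B : nat) (inp : seq bool).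
Local Notation J := (ncoord M).

Lemma cut_ext a f f' : a <= J.+1 -> (forall k, k < vdim M -> f k = f' k) ->
  cut M a f = cut M a f'.
Proof.
move=> aJ e; apply/funext => k; rewrite /cut; case: ifP => // kJ.
by apply: e; rewrite /vdim; lia.
Qed.

(** Needed because the variables after the digits of the first vertex are those of the second, not
    zeros: agreement holds only below [vdim M]. *)
Lemma kind_ext f f' : (forall k, k < vdim M -> f k = f' k) ->
  kind M P0 END B inp f = kind M P0 END B inp f'.
Proof.
move=> e; have e0 : f 0 = f' 0 by apply: e.
rewrite /kind e0; suff -> : kcond M P0 END B inp (f' 0) f = kcond M P0 END B inp (f' 0) f' by [].
by rewrite /kcond /upart /zpart !(cut_ext (f' := f')) // !e // /vdim; lia.
Qed.

Lemma radj_ext f f' g g' : (forall k, k < vdim M -> f k = f' k) ->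
  (forall k, k < vdim M -> g k = g' k) ->
  radj M P0 END B inp f g = radj M P0 END B inp f' g'.
Proof.
move=> e e'; rewrite /radj (kind_ext e) (kind_ext e') /upart /zpart.
rewrite !(cut_ext _ e) // !(cut_ext _ e') //; congr (~~ _ && _).
by apply: eq_forallb => k; rewrite e // e'.
Qed.
End Extensionality.

Lemma cgraph_gt0 M P0 END B inp (B8 : 7 < B) :
  0 < #|[set i : 'I_(B ^ vdim M) | 4 < kind M P0 END B inp (digit B (vdim M) i)]|.
Proof.
have : 0 < wt (@ccls M P0 END B inp B8) (inr (inr (inr tt))).
  apply: leq_trans (@wt_qh M P0 END B inp B8); rewrite !muln_gt0 !(B_gt0 B8) subn_gt0.
  by rewrite -[X in X < _]expn1 ltn_exp2l // /ncoord; lia.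
case/card_gt0P => i; rewrite inE => /eqP e; apply/card_gt0P; exists i; rewrite inE.
move: e; rewrite /ccls; by case: (kind _ _ _ _ _ _) => [|[|[|[|[|k]]]]].
Qed.

Theorem theorem2 : NP_hard FireFighting.
Proof.
move=> L [M [[p tp] LM]].
have [c [d pb]] := horner_nat_bound p.
(* The summands serve the time bound, the rank of the local data, and the eight tags: ranks and tags
   must be digits. *)
pose c0 := c + #|{: tab M}| + 8; pose D := vdim M.
have [phi phiE] := def_radj M 6 (6 + D); have [psi psiE] := def_isq M 6.
exists (pout c0 d D phi psi); split; first exact: pout_poly_computable.
move=> w; rewrite LM; set x := size w.
(* Consecutive powers of one base, which nested loops can compute: [P0] dominates the running time,
   and [B] is at least eight times [P0], hence exceeds every head position. *)
pose P0 := orig c0 d x; pose B := side c0 d x; pose END := P0 + x.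
have bE : base c0 x = x + c0 by [].
have base8 : 7 < base c0 x by rewrite bE /c0; lia.
have P0gt : 0 < P0 by rewrite /P0 /orig expn_gt0; lia.
have BE : B = base c0 x * P0 by rewrite /B /side expnS.
have B8 : 7 < B by rewrite BE; nia.
have zB : #|{: tab M}| <= B.
  by rewrite BE; apply: (@leq_trans (base c0 x)); [rewrite bE /c0; lia | rewrite leq_pmulr].
have TP : (p.[x])%R <= P0.
  apply: leq_trans (pb x) _; rewrite /P0 /orig bE; case: (d) => // d'.
  by rewrite leq_exp2r // /c0; lia.
have PB : P0 + (p.[x])%R < B by rewrite BE; nia.
have time n cf : steps n (init M w) cf -> n <= (p.[x])%R by apply: tp.
pose inp := binp c0 d w.
have e1 i j : env c0 d D x i j 1 = 0 by rewrite env_low.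
have e3 i j : env c0 d D x i j 3 = B by rewrite env_low.
have e4 i j : env c0 d D x i j 4 = P0 by rewrite env_low.
have e5 i j : env c0 d D x i j 5 = END by rewrite env_low.
have exX i j k : k < D -> env c0 d D x i j (6 + k) = digit B D i k by exact: env_x.
have exY i j k : k < D -> env c0 d D x i j (6 + D + k) = digit B D j k by exact: env_y.
pose G := cgraph M P0 END B inp.
pose m := #|[set i : 'I_(B ^ D) | 4 < kind M P0 END B inp (digit B D i)]|.
have mE : pcount c0 d D psi w = m.
  rewrite /pcount -/x -/inp -[verts _ _ _ _]/(B ^ D) count_ord; apply: eq_card => i; rewrite !inE.
  by rewrite psiE // e3 e4 e5 (@kind_ext M P0 END B inp _ (digit B D i)) // => k kD; apply: exX.
have m0 : 0 < m by apply: cgraph_gt0.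
have -> : pout c0 d D phi psi w = encode G m.
  rewrite /pout -/x -/inp mE -[verts _ _ _ _]/(B ^ D) binsE // /encode.
  congr (_ ++ _ :: _ ++ _); rewrite -val_enum_ord allpairs_mapl allpairs_mapr.
  apply: eq_allpairs => i j; rewrite phiE // e3 e4 e5 /G /=.
  by apply: radj_ext => k kD; [apply: exX | apply: exY].
rewrite FireFighting_encode // (@cgraph_winnable M P0 END B inp B8); split.
  exact: (accepts_clique time TP PB zB).
by case=> U UB cU; exact: (@clique_accepts M w _ P0 B PB U UB cU).
Qed.
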